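(* Let $X:=L^2(\mathbb{R}^+_0,\mathbb{R})$ and let $$\mathcal{U}:=\{u\in L^\infty(\mathbb{R}^+_0,\mathbb{R}):\ u \text{ is eventually exponentially decaying to } 0\},\qquad \|\cdot\|_{\mathcal{U}}:=\|\cdot\|_\infty.$$ Let $A$ be the generator of the left-translation semigroup on $X$, that is, $e^{At}f=f(\cdot+t)$ for $f\in X$ and $t\in\mathbb{R}^+_0$. Let $B\in L(\mathbb{R},X)$ be given by $Bv:=v\,b$ for $v\in\mathbb{R}$, where $b\in X$ is such that $b(\zeta)\ge0$ for $\zeta\in\mathbb{R}^+_0$ and $b\notin L^1(\mathbb{R}^+_0,\mathbb{R})$. Define $$\varphi(t,x_0,u):=e^{At}x_0+\int_0^t e^{A(t-s)}Bu(s)\,ds\qquad((t,x_0,u)\in\mathbb{R}^+_0\times X\times\mathcal{U}).$$ Then $\mathfrak{S}:=(X,\mathcal{U},\varphi)$ is a dynamical system with inputs which has bounded reachability sets, is continuous at the equilibrium point $0$, is zero-input uniformly globally stable and is of weak asymptotic gain $0$, but which is not uniformly locally stable. In particular, $\mathfrak{S}$ is not weakly input-to-state stable.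
   Context: Notation: $\mathbb{R}^+_0=[0,\infty)$; $\|\cdot\|_\infty$ is the standard norm on $L^\infty(\mathbb{R}^+_0,\mathbb{R})$. A function $u$ is eventually exponentially decaying to $0$ if there are $\tau_u\in\mathbb{R}^+_0$ and $C_u,\alpha_u>0$ with $|u(s)|\le C_ue^{-\alpha_us}$ for all $s\ge\tau_u$ (functions in $L^p$ spaces are identified when equal almost everywhere). $L(\mathbb{R},X)$ denotes the bounded linear operators from $\mathbb{R}$ to $X$. $\mathcal{K}$ is the set of continuous strictly increasing functions $\gamma:\mathbb{R}^+_0\to\mathbb{R}^+_0$ with $\gamma(0)=0$. For functions $u_1,u_2$ on $\mathbb{R}^+_0$ and $\tau\in\mathbb{R}^+_0$, the concatenation $u_1\,\&_\tau u_2$ is defined by $(u_1\,\&_\tau u_2)(t)=u_1(t)$ for $t\in[0,\tau)$ and $=u_2(t-\tau)$ for $t\ge\tau$. Dynamical system with inputs: a triple $\mathfrak{S}=(X,\mathcal{U},\varphi)$, where $X$ is a normed linear space with norm $\|\cdot\|$; $\mathcal{U}$ is a non-empty set of functions $u:\mathbb{R}^+_0\to U$ endowed with a norm $\|\cdot\|_{\mathcal{U}}$ (meaning the restriction to $\mathcal{U}$ of a norm on some linear space containing $\mathcal{U}$); and $\varphi:\mathbb{R}^+_0\times X\times\mathcal{U}\to X$ is a map, such that: (1) $u(\cdot+\tau)\in\mathcal{U}$ and $\|u(\cdot+\tau)\|_{\mathcal{U}}\le\|u\|_{\mathcal{U}}$ for all $u\in\mathcal{U}$, $\tau\ge0$;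 (2) $u_1\,\&_\tau u_2\in\mathcal{U}$ for all $u_1,u_2\in\mathcal{U}$, $\tau\ge0$; (3) $\varphi(0,x_0,u)=x_0$ and $\varphi(t+s,x_0,u)=\varphi(t,\varphi(s,x_0,u),u(\cdot+s))$ for all $(x_0,u)\in X\times\mathcal{U}$, $s,t\ge0$; (4) $\varphi(\cdot,x_0,u):\mathbb{R}^+_0\to X$ is continuous for all $(x_0,u)$; (5) if $u_1|_{[0,\tau]}=u_2|_{[0,\tau]}$, then $\varphi(\cdot,x_0,u_1)|_{[0,\tau]}=\varphi(\cdot,x_0,u_2)|_{[0,\tau]}$, for all $x_0\in X$, $u_1,u_2\in\mathcal{U}$, $\tau\ge0$. Notions for $\mathfrak{S}$: - Bounded reachability sets: for all $C>0$ and $\tau>0$, $\sup\{\|\varphi(t,x_0,u)\|:\|x_0\|\le C,\ \|u\|_{\mathcal{U}}\le C,\ t\in[0,\tau]\}<\infty$. - Continuous at the equilibrium point $0$: for all $\varepsilon>0$ and $h>0$ there is $\delta>0$ such that $\|\varphi(t,x_0,u)\|\le\varepsilon$ whenever $t\in[0,h]$, $\|x_0\|\le\delta$, $\|u\|_{\mathcal{U}}\le\delta$. - Uniformly globally stable: there exist $\underline\sigma,\underline\gamma\in\mathcal{K}$ such that ( * ) $\|\varphi(t,x_0,u)\|\le\underline\sigma(\|x_0\|)+\underline\gamma(\|u\|_{\mathcal{U}})$ for all $t\ge0$, holds for all $(x_0,u)\in X\times\mathcal{U}$. - Uniformly locally stable: there exist $\underline\sigma,\underline\gamma\in\mathcal{K}$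 and $r>0$ such that ( * ) holds for all $(x_0,u)\in X\times\mathcal{U}$ with $\|x_0\|\le r$ and $\|u\|_{\mathcal{U}}\le r$. - Zero-input uniformly globally stable: $0\in\mathcal{U}$ and the restricted system $(X,\{0\},\varphi)$ is uniformly globally stable. - Of weak asymptotic gain $\overline\gamma$, where $\overline\gamma\in\mathcal{K}\cup\{0\}$: for every $\varepsilon>0$ and $(x_0,u)\in X\times\mathcal{U}$ there is $\overline\tau(\varepsilon,x_0,u)\in\mathbb{R}^+_0$ with $\|\varphi(t,x_0,u)\|\le\varepsilon+\overline\gamma(\|u\|_{\mathcal{U}})$ for all $t\ge\overline\tau(\varepsilon,x_0,u)$. - Weakly input-to-state stable: uniformly globally stable and of weak asymptotic gain $\overline\gamma$ for some $\overline\gamma\in\mathcal{K}\cup\{0\}$. *)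

(* Defs.v *)
From HB Require Import structures.
From mathcomp Require Import all_boot all_order all_algebra.
From mathcomp Require Import all_classical all_reals all_analysis.
From mathcomp Require Import measurable_realfun ess_sup_inf.

Set Implicit Arguments.
Unset Strict Implicit.
Unset Printing Implicit Defensive.

Import Order.TTheory GRing.Theory Num.Theory.
Import numFieldNormedType.Exports.

Local Open Scope classical_set_scope.
Local Open Scope ring_scope.

Section Lspace_normedMod.
Context d (T : measurableType d) (R : realType).
Variable mu : {measure set T -> \bar R}.
Variables (p : \bar R) (p1 : (1 <= p)%E).

Notation L := (LspaceType mu p1).
Notation ty := (LfunType mu p1).

HB.instance Definition _ := gen_eqMixin L.
HB.instance Definition _ := gen_choiceMixin L.

Lemma Lspace_eqP (f g : L) : f = g <-> {ae mu, forall x, f x = g x}.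
Proof.
split=> [->|]; first exact: nearW.
case: f g => [f [[fp]]] [g [[gp]]] /= fg.
have fg' : f = g.
  rewrite -[f]reprK -[g]reprK; apply/eqmodP/asboolP.
  by apply: filterS fg => x + _.
subst g; congr LebesgueSpace.Pack; congr LebesgueSpace.Class.
by congr isFinLebesgue.Axioms_; exact: Prop_irrelevance.
Qed.

Lemma Lspace_Lfun (f : L) : (f : T -> R) \in Lfun mu p.
Proof.
apply/andP; split; rewrite inE/=; first exact: (@measurable_funPT _ _ _ _ (repr (LebesgueSpace.sort f))).
exact: Lebesgue_finite.
Qed.

Definition Lfun_of (f : L) : ty := Lfun_Sub p1 (Lspace_Lfun f).

(* [R] and [measurableTypeR R] carry the same sigma-algebra under different
   displays; the quotient below is built on the latter. *)
Lemma measurable_Lfun (f : ty) :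
  measurable_fun setT (f : T -> measurableTypeR R).
Proof. by move=> mT Y mY; exact: (measurable_funPT f). Qed.

Definition mfun_of (f : ty) : {mfun T >-> measurableTypeR R} :=
  HB.pack_for {mfun T >-> measurableTypeR R} (f : T -> measurableTypeR R)
    (isMeasurableFun.Build _ _ _ _ (f : T -> measurableTypeR R)
      (measurable_Lfun f)).

Definition aeclass (f : ty) : {mfun_ mu, T >-> measurableTypeR R} :=
  (\pi_({mfun_ mu, T >-> measurableTypeR R}) (mfun_of f))%qT.

Lemma aeclassE (f : ty) : {ae mu, forall x, aeclass f x = f x}.
Proof.
have /eqmodP/asboolP :
    (\pi_({mfun_ mu, T >-> measurableTypeR R}) (repr (aeclass f))
     = \pi_({mfun_ mu, T >-> measurableTypeR R}) (mfun_of f))%qT.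
  by rewrite reprK.
by apply: filterS => x; exact.
Qed.

Lemma eq_ae_Lnorm (f g : T -> R) : measurable_fun setT f -> measurable_fun setT g ->
  {ae mu, forall x, f x = g x} ->
  ('N[mu]_p[EFin \o f] = 'N[mu]_p[EFin \o g])%E.
Proof.
move=> mf mg fg; rewrite unlock; case: p p1 => [r r1|_|//].
- have mp (h : T -> R) : measurable_fun setT h ->
      measurable_fun setT ((fun x => `|(EFin \o h) x| `^ r)%E : T -> \bar R).
    move=> mh; apply: (@measurableT_comp _ _ _ _ _ _ (fun x => x `^ r)%E) => /=.
      exact: measurable_poweR.
    by apply: measurableT_comp => //; exact: measurableT_comp.
  congr (_ `^ _)%E; apply: ae_eq_integral => //; [exact: mp|exact: mp|].
  by apply: filterS fg => x /= -> _.
- case: ifPn => // mu0; apply: eq_ess_sup.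
  by apply: filterS fg => x /= ->.
Qed.

Lemma measurable_Lspace (f : L) : measurable_fun setT (f : T -> R).
Proof. by have /andP[/[!inE]] := Lspace_Lfun f. Qed.

Lemma finite_norm_aeclass (f : ty) : finite_norm mu p (aeclass f).
Proof.
rewrite /finite_norm (@eq_ae_Lnorm _ f) //; last exact: aeclassE.
- exact: Lfunction_finite.
- exact: (@measurable_funPT _ _ _ _ (repr (aeclass f))).
Qed.

HB.instance Definition _ (f : ty) :=
  isFinLebesgue.Build d T R mu p p1 (aeclass f) (finite_norm_aeclass f).

Definition Lspace_of (f : ty) : L := aeclass f.

Lemma Lspace_ofE (f : ty) : {ae mu, forall x, Lspace_of f x = f x}.
Proof. exact: aeclassE. Qed.

Lemma Lfun_ofK : cancel Lfun_of Lspace_of.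
Proof. by move=> f; apply/Lspace_eqP; exact: Lspace_ofE. Qed.

Definition Lspace_zero : L := Lspace_of 0.
Definition Lspace_opp (f : L) : L := Lspace_of (- Lfun_of f).
Definition Lspace_add (f g : L) : L := Lspace_of (Lfun_of f + Lfun_of g).
Definition Lspace_scale (a : R) (f : L) : L := Lspace_of (a *: Lfun_of f).

Lemma Lspace_zeroE : {ae mu, forall x, Lspace_zero x = 0}.
Proof. exact: Lspace_ofE. Qed.

Lemma Lspace_oppE f : {ae mu, forall x, Lspace_opp f x = - f x}.
Proof. exact: Lspace_ofE. Qed.

Lemma Lspace_addE f g : {ae mu, forall x, Lspace_add f g x = f x + g x}.
Proof. exact: Lspace_ofE. Qed.

Lemma Lspace_scaleE a f : {ae mu, forall x, Lspace_scale a f x = a * f x}.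
Proof. exact: Lspace_ofE. Qed.

Lemma Lspace_addA : associative Lspace_add.
Proof.
move=> f g h; apply/Lspace_eqP.
apply: filterS3 (Lspace_addE f (Lspace_add g h)) (Lspace_addE g h)
  (filterI (Lspace_addE (Lspace_add f g) h) (Lspace_addE f g)).
move=> x -> -> [-> ->].
exact: addrA.
Qed.

Lemma Lspace_addC : commutative Lspace_add.
Proof.
move=> f g; apply/Lspace_eqP.
by apply: filterS2 (Lspace_addE f g) (Lspace_addE g f) => x -> ->; exact: addrC.
Qed.

Lemma Lspace_add0 : left_id Lspace_zero Lspace_add.
Proof.
move=> f; apply/Lspace_eqP.
by apply: filterS2 (Lspace_addE Lspace_zero f) Lspace_zeroE => x -> ->; exact: add0r.
Qed.

Lemma Lspace_addN : left_inverse Lspace_zero Lspace_opp Lspace_add.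
Proof.
move=> f; apply/Lspace_eqP.
apply: filterS3 (Lspace_addE (Lspace_opp f) f) (Lspace_oppE f) Lspace_zeroE.
by move=> x -> -> ->; exact: addNr.
Qed.

HB.instance Definition _ := GRing.isZmodule.Build L
  Lspace_addA Lspace_addC Lspace_add0 Lspace_addN.

Lemma Lspace_scaleA a b (f : L) :
  Lspace_scale a (Lspace_scale b f) = Lspace_scale (a * b) f.
Proof.
apply/Lspace_eqP; apply: filterS3 (Lspace_scaleE a (Lspace_scale b f))
  (Lspace_scaleE b f) (Lspace_scaleE (a * b) f) => x -> -> ->.
exact: mulrA.
Qed.

Lemma Lspace_scale1 : left_id 1 Lspace_scale.
Proof.
move=> f; apply/Lspace_eqP.
by apply: filterS (Lspace_scaleE 1 f) => x ->; exact: mul1r.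
Qed.

Lemma Lspace_scaleDr : right_distributive Lspace_scale +%R.
Proof.
move=> a f g; apply/Lspace_eqP.
apply: filterS3 (Lspace_addE (Lspace_scale a f) (Lspace_scale a g))
  (filterI (Lspace_scaleE a (f + g)) (Lspace_addE f g))
  (filterI (Lspace_scaleE a f) (Lspace_scaleE a g)).
by move=> x -> [-> ->] [-> ->]; exact: mulrDr.
Qed.

Lemma Lspace_scaleDl f : {morph Lspace_scale^~ f : a b / a + b}.
Proof.
move=> a b; apply/Lspace_eqP.
apply: filterS3 (Lspace_scaleE (a + b) f)
  (Lspace_addE (Lspace_scale a f) (Lspace_scale b f))
  (filterI (Lspace_scaleE a f) (Lspace_scaleE b f)).
by move=> x -> -> [-> ->]; exact: mulrDl.
Qed.

HB.instance Definition _ := GRing.Zmodule_isLmodule.Build R L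
  Lspace_scaleA Lspace_scale1 Lspace_scaleDr Lspace_scaleDl.

Definition Lspace_norm (f : L) : R := fine ('N[mu]_p[EFin \o f]).

Lemma Lspace_norm_of (f : ty) :
  Lspace_norm (Lspace_of f) = fine ('N[mu]_p[EFin \o f]).
Proof.
congr fine; apply: eq_ae_Lnorm; [exact: measurable_Lspace| by [] |].
exact: Lspace_ofE.
Qed.

Lemma Lspace_normD f g : Lspace_norm (f + g) <= Lspace_norm f + Lspace_norm g.
Proof. by rewrite Lspace_norm_of; exact: (ler_LnormD (Lfun_of f) (Lfun_of g)). Qed.

Lemma Lspace_normZ a f : Lspace_norm (a *: f) = `|a| * Lspace_norm f.
Proof.
rewrite Lspace_norm_of (LnormZ (Lfun_of f) a) fineM//.
by rewrite -(finite_norm_fine (Lfun_of f)).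
Qed.

Lemma Lspace_norm_eq0 f : Lspace_norm f = 0 -> f = 0.
Proof.
move=> /(@fine_Lnormr_eq0 _ _ _ _ _ p1 (Lfun_of f)) f0; apply/Lspace_eqP.
by apply: filterS2 f0 Lspace_zeroE => x /(_ I) fx ->.
Qed.

HB.instance Definition _ := Lmodule_isNormed.Build R L
  Lspace_normD Lspace_normZ Lspace_norm_eq0.

End Lspace_normedMod.

Section bochner.
Context d (T : measurableType d) (R : realType) (X : normedModType R).
Variables (mu : {measure set T -> \bar R}) (D : set T).
Implicit Types (f g : T -> X).

Definition integrable_simple g : Prop :=
  [/\ finite_set (range g), forall x, measurable (g @^-1` [set x]) &
      forall x, x != 0 -> (mu (D `&` g @^-1` [set x]) < +oo)%E].

(* The summand at [x = 0] vanishes even when its preimage has infinite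
   measure, since [fine +oo = 0]. *)
Definition simple_integral g : X :=
  \sum_(x \in range g) fine (mu (D `&` g @^-1` [set x])) *: x.

Definition strongly_measurable f : Prop :=
  exists g_ : nat -> T -> X, (forall n, integrable_simple (g_ n)) /\
    {ae mu, forall s, D s -> g_ ^~ s @ \oo --> f s}.

Definition is_bochner_integral f (I : X) : Prop :=
  strongly_measurable f /\
  exists g_ : nat -> T -> X,
    [/\ forall n, integrable_simple (g_ n),
        (\int[mu]_(s in D) (`|f s - g_ n s|)%:E)%E @[n --> \oo] --> 0%E &
        simple_integral (g_ n) @[n --> \oo] --> I].

(* Total operator, with value 0 when f is not Bochner integrable on D. *)
Definition bochner_integral f : X := xget 0 (is_bochner_integral f).

End bochner.

(* Functions on [0, +oo[ are represented by functions on R, of which only the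
   values on [0, +oo[ matter. *)

Definition shift_fun (R : realType) (U : Type) (tau : R) (u : R -> U) : R -> U :=
  fun t => u (t + tau).

Definition concat_fun (R : realType) (U : Type) (tau : R) (u1 u2 : R -> U) :
    R -> U :=
  fun t => if t < tau then u1 t else u2 (t - tau).

Section input_system.
Context (R : realType).
(* X is the state space; V is the normed linear space containing the set
   [Inp] of inputs. Elements of V may be functions up to an identification
   such as equality almost everywhere: [rep u f] says that the function f is a
   representative of u. *)
Context (X V : normedModType R) (U : Type) (rep : V -> (R -> U) -> Prop).
Variables (Inp : set V) (phi : R -> X -> V -> X).

(* v = u(. + tau), whichever representative of u is used; likewise below. *)
Definition is_shift (tau : R) (u v : V) : Prop :=
  forall f, rep u f -> rep v (shift_fun tau f).

Definition is_concat (tau : R) (u1 u2 v : V) : Prop :=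
  forall f1 f2, rep u1 f1 -> rep u2 f2 -> rep v (concat_fun tau f1 f2).

Definition agree_upto (tau : R) (u1 u2 : V) : Prop :=
  exists f1 f2, [/\ rep u1 f1, rep u2 f2 &
    forall t, 0 <= t <= tau -> f1 t = f2 t].

Record dynamical_system_with_inputs : Prop := {
  inputs_nonempty : Inp !=set0 ;
  inputs_rep : forall u, Inp u -> exists f, rep u f ;
  inputs_rep_inj : forall u v f, Inp u -> Inp v -> rep u f -> rep v f -> u = v ;
  inputs_shift : forall u tau, Inp u -> 0 <= tau ->
    exists v, [/\ Inp v, is_shift tau u v & `|v| <= `|u|] ;
  inputs_concat : forall u1 u2 tau, Inp u1 -> Inp u2 -> 0 <= tau ->
    exists2 v, Inp v & is_concat tau u1 u2 v ;
  flow0 : forall x0 u, Inp u -> phi 0 x0 u = x0 ;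
  flowD : forall x0 u v t s, Inp u -> 0 <= s -> 0 <= t ->
    Inp v -> is_shift s u v -> phi (t + s) x0 u = phi t (phi s x0 u) v ;
  flow_continuous : forall x0 u, Inp u ->
    {within `[0, +oo[, continuous (fun t : R => phi t x0 u)} ;
  flow_causal : forall x0 u1 u2 tau, Inp u1 -> Inp u2 -> 0 <= tau ->
    agree_upto tau u1 u2 ->
    forall t, 0 <= t <= tau -> phi t x0 u1 = phi t x0 u2 }.

Definition bounded_reachability_sets : Prop :=
  forall C tau : R, 0 < C -> 0 < tau ->
    has_ubound [set r : R | exists t x0 u,
      [/\ 0 <= t <= tau, `|x0| <= C, Inp u, `|u| <= C & r = `|phi t x0 u|]].

Definition continuous_at_equilibrium0 : Prop :=
  forall eps h : R, 0 < eps -> 0 < h -> exists2 delta : R, 0 < delta &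
    forall t x0 u, 0 <= t <= h -> `|x0| <= delta -> Inp u -> `|u| <= delta ->
      `|phi t x0 u| <= eps.

End input_system.

(* Functions from [0, +oo[ to itself: nonnegativity there follows from
   [gamma 0 = 0] and monotonicity; values on the negative half-line are
   unconstrained. *)
Definition classK (R : realType) (gamma : R -> R) : Prop :=
  [/\ {within `[0, +oo[, continuous gamma},
      {in `[0, +oo[ &, {homo gamma : r s / r < s}} & gamma 0 = 0].

Section stability.
Context (R : realType) (X V : normedModType R).
Variables (Inp : set V) (phi : R -> X -> V -> X).

Definition stability_estimate (sigma gamma : R -> R) (x0 : X) (u : V) : Prop :=
  forall t, 0 <= t -> `|phi t x0 u| <= sigma `|x0| + gamma `|u|.

Definition uniformly_globally_stable : Prop :=
  exists sigma gamma, [/\ classK sigma, classK gamma &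
    forall x0 u, Inp u -> stability_estimate sigma gamma x0 u].

Definition uniformly_locally_stable : Prop :=
  exists sigma gamma r, [/\ classK sigma, classK gamma, 0 < r &
    forall x0 u, Inp u -> `|x0| <= r -> `|u| <= r ->
      stability_estimate sigma gamma x0 u].

(* The first conjunct is the membership of gamma in K united with {0}. *)
Definition of_weak_asymptotic_gain (gamma : R -> R) : Prop :=
  (classK gamma \/ gamma = cst 0) /\
  forall (eps : R) x0 u, 0 < eps -> Inp u ->
    exists2 tau : R, 0 <= tau &
      forall t, tau <= t -> `|phi t x0 u| <= eps + gamma `|u|.

Definition weakly_input_to_state_stable : Prop :=
  uniformly_globally_stable /\ exists gamma, of_weak_asymptotic_gain gamma.

End stability.

Definition zero_input_uniformly_globally_stable (R : realType)
    (X V : normedModType R) (Inp : set V) (phi : R -> X -> V -> X) : Prop :=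
  Inp 0 /\ uniformly_globally_stable [set 0] phi.

Section translation_system.
Context (R : realType).

(* Lebesgue measure on [0, +oo[, as a measure on R that ignores the negative
   half-line; hence [LspaceType Rplus_measure p1] is L^p([0, +oo[, R). *)
Definition Rplus_measure : {measure set (measurableTypeR R) -> \bar R} :=
  mrestr (@lebesgue_measure R) (measurable_itv `[0, +oo[).

Local Notation X := (LspaceType Rplus_measure (lee1n 2)).
Local Notation V := (LspaceType Rplus_measure (leey 1%E)).

(* [left_translation t] is e^{At}, A being the generator of the left-translation
   semigroup: the class of f(. + t). Only 0 <= t is meaningful. *)
Definition left_translation (t : R) (f : X) : X :=
  xget 0 [set g : X | {ae Rplus_measure, forall x : R, g x = f (x + t)}].

Definition rank_one_operator (b : X) : R -> X := fun v => v *: b.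

(* S is the operator semigroup e^{A.}. *)
Definition mild_solution (S : R -> X -> X) (B : R -> X)
    (t : R) (x0 : X) (u : R -> R) : X :=
  S t x0 +
  bochner_integral (@lebesgue_measure R) `[0, t] (fun s : R => S (t - s) (B (u s))).

(* The class u enters through its chosen representative; the integral does not
   depend on that choice. *)
Definition translation_flow (b : X) (t : R) (x0 : X) (u : V) : X :=
  mild_solution left_translation (rank_one_operator b) t x0 u.

Definition ae_representative (u : V) (f : R -> R) : Prop :=
  {ae Rplus_measure, forall s : R, f s = u s}.

Definition eventually_exp_decaying (u : V) : Prop :=
  exists tau C alpha : R, [/\ 0 <= tau, 0 < C, 0 < alpha &
    {ae Rplus_measure, forall s : R, tau <= s -> `|u s| <= C * expR (- alpha * s)}].

Definition decaying_inputs : set V := [set u | eventually_exp_decaying u].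

End translation_system.

Notation L1_Rplus R := (Lfun (Rplus_measure R) 1%E).
Notation L2_Rplus R := (LspaceType (Rplus_measure R) (lee1n 2)).

(* Main.v *)
Require Import Defs.
From HB Require Import structures.
From mathcomp Require Import all_boot all_order all_algebra.
From mathcomp Require Import finmap.
From mathcomp Require Import all_classical all_reals all_analysis.
From mathcomp Require Import measurable_realfun ess_sup_inf.
From mathcomp Require Import ring lra zify.

Set Implicit Arguments.
Unset Strict Implicit.
Unset Printing Implicit Defensive.

Import Order.TTheory GRing.Theory Num.Theory.
Import numFieldNormedType.Exports.

Local Open Scope classical_set_scope.
Local Open Scope ring_scope.

(** Write S for the left-translation semigroup.  The mild solution is
    S t x0 + I(t), where the response I(t) is the Bochner integral over [0, t]
    of u(s) S(t - s) b.  Everything rests on a concrete description of that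
    integral ([duhamel_integral]): for almost every x,

      I(t)(x) = int_0^t u(s) b(x + t - s) ds,

    and the norm of I(t) is at most the integral of |u(s)| |b| over [0, t].

    To obtain it, a function s |-> f(s) with values in L2 is described by a
    kernel F(s, x), a jointly measurable choice of representatives.  The
    integral Minkowski inequality ([minkowski_integral], a consequence of
    Cauchy-Schwarz and Tonelli) shows that x |-> int F(s, x) ds is in L2, with
    norm at most the integral of the norms |f(s)|.  Applied to f - h with h
    simple, it shows that the integrals of any simple functions h_n with
    int |f - h_n| -> 0 converge to this element: it is therefore the only
    possible Bochner integral ([bochner_integral_kernel]).  Simple approximants
    are obtained by rounding u and the time s, and they converge since S is
    strongly continuous ([left_translation_cvg]), which itself follows from the
    density of continuous functions in L1.

    With the formula, the axioms of a dynamical system are pointwise identities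
    between integrals over [0, t] ([duhamelD], [duhamelB],
    [duhamel_left_translation]), and the norm bound gives bounded reachability,
    continuity at 0 and the estimate for the zero input.  The weak asymptotic
    gain is 0 because a decaying input is integrable: after a late enough
    restart the remaining input contributes less than any prescribed amount,
    and the state at the restart is forgotten, as |S t f|^2 is the tail of the
    integral of f^2 ([left_translation_cvg0]).

    Local stability fails because the norm of the response is controlled by the
    L1 norm of u only, not by its supremum.  The inputs equal to r on [0, n] and
    to 0 afterwards have norm at most r, but their response at time n is, on
    [0, 1], at least r times the integral of b over [1, n]
    ([duhamel_indicator_lower]); this is unbounded in n as b >= 0 is square
    integrable without being integrable ([integral_tail_unbounded]). *)

(** * Almost everywhere reasoning *)

Section almost_everywhere.
Context d (T : measurableType d) (R : realType) (mu : {measure set T -> \bar R}).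
Implicit Types P Q S : T -> Prop.

(** Quantifying over a bundled measure lets the measure structure be read off
    the hypothesis. *)
Lemma ae_sub P Q : (forall x, P x -> Q x) ->
  {ae mu, forall x, P x} -> {ae mu, forall x, Q x}.
Proof. by move=> PQ; apply: filterS. Qed.

Lemma ae_sub2 P Q S : (forall x, P x -> Q x -> S x) ->
  {ae mu, forall x, P x} -> {ae mu, forall x, Q x} -> {ae mu, forall x, S x}.
Proof. by move=> PQ; apply: filterS2. Qed.

Lemma ae_mp P Q :
  {ae mu, forall x, P x} -> {ae mu, forall x, P x -> Q x} -> {ae mu, forall x, Q x}.
Proof. by apply: filterS2 => x Px; apply. Qed.

End almost_everywhere.

(** * The integral Minkowski inequality *)

Section square_integral.
Context d (T : measurableType d) (R : realType) (mu : {measure set T -> \bar R}).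
Implicit Types f g : T -> R.
Local Open Scope ereal_scope.

Lemma poweR2 (x : \bar R) : 0 <= x -> x `^ 2 = x * x.
Proof.
move: x => [r|_|//].
- by rewrite lee_fin poweR_EFin => r0; rewrite powR_mulrn// expr2 EFinM.
- by rewrite poweRyr// mulyy.
Qed.

Lemma Lnorm2_sqr f :
  'N[mu]_2%:E[EFin \o f] * 'N[mu]_2%:E[EFin \o f] =
  \int[mu]_x ((f x) ^+ 2)%:E.
Proof.
rewrite -poweR2 ?Lnorm_ge0// poweR_Lnorm//.
apply: eq_integral => x _.
by rewrite poweR2//= -EFinM -expr2 real_normK// num_real.
Qed.

Lemma cauchy_schwarz f g :
  measurable_fun setT f -> measurable_fun setT g ->
  (\int[mu]_x `|(f x * g x)%:E|) * (\int[mu]_x `|(f x * g x)%:E|) <=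
  (\int[mu]_x (f x ^+ 2)%:E) * (\int[mu]_x (g x ^+ 2)%:E).
Proof.
move=> mf mg.
have := @hoelder _ _ _ mu f g 2 2 mf mg (ltr0n _ 2) (ltr0n _ 2).
rewrite -[in X in X -> _]div1r -splitr => /(_ erefl).
rewrite Lnorm1 -!Lnorm2_sqr => h.
rewrite [leRHS]muleACA; apply: lee_pmul => //; exact: integral_ge0.
Qed.

End square_integral.

Section minkowski_integral.
Context d1 d2 (T1 : measurableType d1) (T2 : measurableType d2) (R : realType).
Variables (m1 : {sigma_finite_measure set T1 -> \bar R})
          (m2 : {sigma_finite_measure set T2 -> \bar R}).
Local Open Scope ereal_scope.

(** Cauchy-Schwarz for G = sqrt w * (G / sqrt w) gives
    (int |G(s, x)| ds)^2 <= W * int G(s, x)^2 / w(s) ds.  Integrate in x and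
    exchange the integrals: as G(s, .)^2 has integral at most w(s)^2, what is
    left is at most W * int w.  Since G vanishes where w does, the convention
    0^-1 = 0 makes the factorization valid there too. *)
Lemma minkowski_integral_weight (G : T1 * T2 -> R) (w : T1 -> R) (W : R) :
  measurable_fun setT G -> measurable_fun setT w ->
  (forall s, (0 <= w s)%R) -> (forall s, w s = 0%R -> forall x, G (s, x) = 0%R) ->
  (forall s, \int[m2]_x (G (s, x) ^+ 2)%:E <= (w s ^+ 2)%:E) ->
  \int[m1]_s (w s)%:E <= W%:E ->
  \int[m2]_x ((\int[m1]_s `|(G (s, x))%:E|) * (\int[m1]_s `|(G (s, x))%:E|))
    <= (W ^+ 2)%:E.
Proof.
move=> mG mw w0 wG Gw wW.
have W0 : (0 <= W)%R.
  by rewrite -lee_fin (le_trans _ wW)// integral_ge0// => s _; rewrite lee_fin.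
pose K (z : T1 * T2) := ((Num.sqrt (w z.1))^-1 * G z)%R.
have ms : measurable_fun setT (fun s => Num.sqrt (w s)).
  rewrite (_ : (fun _ => _) = (fun s => w s `^ 2^-1)%R); last first.
    by apply/funext => s; rewrite powR12_sqrt.
  exact: (measurableT_comp (measurable_powR _) mw).
have mK : measurable_fun setT K.
  apply: measurable_funM => //.
  rewrite (_ : (fun _ => _) = (fun z => w z.1 `^ (- 2^-1))%R); last first.
    by apply/funext => z; rewrite powRN powR12_sqrt.
  apply: (measurableT_comp (measurable_powR _)).
  exact: (measurableT_comp mw measurable_fst).
have mK2 : measurable_fun setT (fun z => (K z ^+ 2)%:E).
  by apply/measurable_EFinP; exact: measurable_funX.
have K0 z : 0 <= (K z ^+ 2)%:E by rewrite lee_fin sqr_ge0.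
pose A x := \int[m1]_s `|(G (s, x))%:E|.
pose Q x := \int[m1]_s (K (s, x) ^+ 2)%:E.
have mA : measurable_fun setT A.
  apply: (measurable_fun_fubini_tonelli_G (fun z => `|(G z)%:E|)) => //.
  by apply: measurableT_comp => //; exact/measurable_EFinP.
have mQ : measurable_fun setT Q.
  exact: (measurable_fun_fubini_tonelli_G (fun z => (K z ^+ 2)%:E)).
have Q0 x : 0 <= Q x by apply: integral_ge0.
have AQ x : A x * A x <= W%:E * Q x.
  have -> : A x = \int[m1]_s `|(Num.sqrt (w s) * K (s, x))%:E|.
    apply: eq_integral => s _; rewrite /K/=.
    have [ws0|ws0] := eqVneq (w s) 0%R; first by rewrite wG// mulr0 mulr0.
    by rewrite mulVKf// sqrtr_eq0 -ltNge lt_def ws0 w0.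
  have mKx : measurable_fun setT (fun s => K (s, x)).
    exact: measurable_fun_pair1.
  apply: (le_trans (cauchy_schwarz m1 ms mKx)).
  apply: lee_wpmul2r; first exact: Q0.
  by under eq_integral do rewrite sqr_sqrtr//.
apply: (@le_trans _ _ (\int[m2]_x (W%:E * Q x))).
  apply: ge0_le_integral => //.
  - by move=> x _; rewrite mule_ge0// integral_ge0.
  - exact: emeasurable_funM.
  - exact: emeasurable_funM.
  - by move=> x _; exact: AQ.
rewrite ge0_integralZl_EFin// expr2 EFinM.
apply: lee_wpmul2l; first by rewrite lee_fin.
rewrite -(fubini_tonelli (fun z => (K z ^+ 2)%:E))//.
apply: le_trans wW; apply: ge0_le_integral => //.
- by move=> s _; exact: integral_ge0.
- exact: (measurable_fun_fubini_tonelli_F (fun z => (K z ^+ 2)%:E)).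
- exact/measurable_EFinP.
move=> s _.
under eq_integral do rewrite /K/= exprMn EFinM.
rewrite ge0_integralZl_EFin//; last 2 first.
- by move=> x _; rewrite lee_fin sqr_ge0.
- apply/measurable_EFinP/measurable_funX.
  exact: measurable_fun_pair2.
rewrite exprVn sqr_sqrtr//.
apply: (@le_trans _ _ ((w s)^-1%:E * (w s ^+ 2)%:E)).
  by apply: lee_wpmul2l; rewrite ?lee_fin ?invr_ge0.
rewrite -EFinM lee_fin; have [->|ws0] := eqVneq (w s) 0%R; first by rewrite invr0 mul0r.
by rewrite expr2 mulKf.
Qed.


(** Where w(s) = 0 the function G(s, .) vanishes only almost everywhere, so the
    weighted inequality is applied to w + e on D; as D has finite measure, e
    can then go to 0. *)
Lemma minkowski_integral (D : set T1) (G : T1 * T2 -> R) (w : T1 -> R) (W : R) :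
  measurable D -> m1 D < +oo ->
  measurable_fun setT G -> measurable_fun D w -> (forall s, D s -> (0 <= w s)%R) ->
  (forall s, D s -> \int[m2]_x (G (s, x) ^+ 2)%:E <= (w s ^+ 2)%:E) ->
  \int[m1]_(s in D) (w s)%:E <= W%:E ->
  \int[m2]_x ((\int[m1]_(s in D) `|(G (s, x))%:E|) *
              (\int[m1]_(s in D) `|(G (s, x))%:E|)) <= (W ^+ 2)%:E.
Proof.
move=> mD Doo mG mw w0 Gw wW.
set L := (X in X <= _).
have W0 : (0 <= W)%R.
  by rewrite -lee_fin (le_trans _ wW)// integral_ge0// => s Ds; rewrite lee_fin w0.
pose M := fine (m1 D).
have M0 : (0 <= M)%R by rewrite fine_ge0.
have ME : m1 D = M%:E by rewrite fineK// ge0_fin_numE.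
have He (e : R) : (0 < e)%R -> L <= ((W + e * M) ^+ 2)%:E.
  move=> e0.
  pose G' (z : T1 * T2) : R := (\1_D z.1 * G z)%R.
  pose w' := ((fun s => w s + e)%R \_ D).
  have -> : L = \int[m2]_x ((\int[m1]_s `|(G' (s, x))%:E|) *
                            (\int[m1]_s `|(G' (s, x))%:E|)).
    have E x : \int[m1]_(s in D) `|(G (s, x))%:E| = \int[m1]_s `|(G' (s, x))%:E|.
      rewrite integral_mkcond; apply: eq_integral => s _.
      rewrite patchE /G' indicE/=; case: ifPn => sD; first by rewrite mul1r.
      by rewrite mul0r normr0.
    by apply: eq_integral => x _; rewrite E.
  apply: (@minkowski_integral_weight G' w').
  - apply: measurable_funM => //.
    by apply: (measurableT_comp (measurable_indic mD)); exact: measurable_fst.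
  - apply/(measurable_restrictT _ mD).1.
    exact: measurable_funD.
  - move=> s; rewrite /w' patchE; case: ifPn => // /set_mem Ds.
    by rewrite addr_ge0// ?w0// ltW.
  - move=> s ws x; move: ws; rewrite /w' /G' patchE indicE/=.
    case: ifPn => sD ws; last first.
      by rewrite mul0r.
    have := ltr_wpDl (w0 _ (set_mem sD)) e0.
    by rewrite ws ltxx.
  - move=> s; rewrite /w' /G' patchE/=; under eq_integral do rewrite indicE/=.
    case: ifPn => sD; last first.
      by under eq_integral do rewrite mul0r expr0n/=; rewrite integral0 expr0n.
    under eq_integral do rewrite mul1r.
    have Ds := set_mem sD.
    apply: (le_trans (Gw _ Ds)); rewrite lee_fin lerXn2r ?nnegrE//.
    - by rewrite w0.
    - by rewrite addr_ge0 ?w0// ltW.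
    - by rewrite lerDl ltW.
  - rewrite (_ : \int[m1]_s _ = \int[m1]_(s in D) ((w s)%:E + e%:E)); last first.
      rewrite [RHS]integral_mkcond; apply: eq_integral => s _.
      by rewrite /w' !patchE; case: ifPn.
    rewrite ge0_integralD//; last 2 first.
    - exact/measurable_EFinP.
    - by move=> s Ds; rewrite lee_fin ltW.
    have -> : \int[m1]_(x in D) e%:E = (e * M)%:E.
      by rewrite integral_cst// EFinM -ME.
    by rewrite EFinD leeD.
have L0 : 0 <= L.
  apply: integral_ge0 => x _; apply: mule_ge0; exact: integral_ge0.
have Lfin : L \is a fin_num.
  by rewrite ge0_fin_numE// (le_lt_trans (He 1%R ltr01))// ltry.
rewrite -(fineK Lfin) lee_fin; set l := fine L.
have He' (e : R) : (0 < e)%R -> (l <= (W + e * M) ^+ 2)%R.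
  by move=> e0; rewrite -lee_fin fineK// He.
have l0 : (0 <= l)%R by exact: fine_ge0.
rewrite -(sqr_sqrtr l0) lerXn2r ?nnegrE ?sqrtr_ge0//.
apply/ler_addgt0Pr => e e0.
have e'0 : (0 < e / (M + 1))%R by rewrite divr_gt0// ltr_wpDl.
rewrite -(@ler_pXn2r _ 2)// ?nnegrE ?sqrtr_ge0//; last by rewrite addr_ge0// ltW.
rewrite sqr_sqrtr//; apply: (le_trans (He' _ e'0)).
rewrite lerXn2r ?nnegrE//.
- by rewrite addr_ge0// mulr_ge0// ltW.
- by rewrite addr_ge0// ltW.
- rewrite lerD2l mulrAC ler_pdivrMr ?ltr_wpDl// ler_pM2l// lerDl//.
Qed.

End minkowski_integral.

(** * Translation invariance and the half-line *)

Section translation.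
Context (R : realType).
Local Notation lam := (@lebesgue_measure R).
Local Notation mT := (measurableTypeR R).

Lemma measurable_shift (t : R) :
  measurable_fun [set: mT] (fun x : mT => (x + t : mT)).
Proof. by apply: measurable_funD. Qed.

Lemma lebesgue_measure_shift (t : R) (A : set R) : measurable A ->
  pushforward lam (fun x : mT => (x + t : mT)) A = lam A.
Proof.
move=> mA; apply/esym.
pose F : {mfun mT >-> mT} :=
  HB.pack (fun x : mT => (x + t : mT))
    (isMeasurableFun.Build _ _ _ _ _ (measurable_shift t)).
apply: (@lebesgue_measure_unique R (pushforward lam F)) => // _ [[a b]] _ <-.
transitivity (lam `]a - t, b - t]%classic).
  rewrite !lebesgue_measure_itv/= !lte_fin ltrD2r; case: ifPn => // _.
  by rewrite -!EFinD opprB addrA subrK.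
congr (lam _); apply/seteqP.
by split=> x /=; rewrite !in_itv/= ltrBlDr lerBrDr.
Qed.

Lemma ge0_integral_shift (t : R) (D : set mT) (f : mT -> \bar R) :
  measurable D -> measurable_fun D f -> (forall x, D x -> (0 <= f x)%E) ->
  (\int[lam]_(x in D) f x =
   \int[lam]_(x in (fun x : R => x + t)%R @^-1` D) f (x + t)%R)%E.
Proof.
move=> mD mf f0.
rewrite -(ge0_integral_pushforward (measurable_shift t) lam mD mf)//.
- apply: eq_measure_integral; first exact: measurable_shift.
  by move=> mF A mA AS; exact: (esym (lebesgue_measure_shift t mA)).
- by move=> y /set_mem; exact: f0.
Qed.

Lemma ae_shift (t : R) (P : R -> Prop) :
  {ae lam, forall x, P x} -> {ae lam, forall x, P (x + t)}.
Proof.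
move=> [N [mN N0 PN]]; exists ((fun x => x + t) @^-1` N); split.
- by rewrite -[X in measurable X]setTI; exact: measurable_shift.
- by rewrite -N0 -[RHS](lebesgue_measure_shift t).
- by move=> x /= Px; exact: PN.
Qed.

End translation.

Section half_line.
Context (R : realType).
Local Notation lam := (@lebesgue_measure R).
Local Notation mT := (measurableTypeR R).
Local Notation mu := (Rplus_measure R).

Lemma ae_RplusP (P : R -> Prop) :
  {ae mu, forall x, P x} <-> {ae lam, forall x, 0 <= x -> P x}.
Proof.
split=> -[N [mN N0 PN]].
- exists (N `&` `[0, +oo[); split => //; first exact: measurableI.
  move=> x /= /not_implyP[x0 nP]; split; first exact: PN.
  by rewrite /= in_itv/= x0.
- exists (N `|` `]-oo, 0[%classic); split.
  + exact: measurableU.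
  + rewrite /Rplus_measure/= /mrestr setIUl.
    rewrite (_ : `]-oo, 0[%classic `&` _ = set0) ?setU0; last first.
      apply/seteqP; split => // x [] /=; rewrite !in_itv/= andbT => x0.
      by rewrite leNgt x0.
    apply: (subset_measure0 _ _ _ N0) => //; exact: measurableI.
  + move=> x /= nP; have [x0|x0] := ltP x 0; first by right; rewrite /= in_itv.
    by left; apply: PN => /= /(_ x0).
Qed.

Lemma ae_Rplus_shift (t : R) (P : R -> Prop) : 0 <= t ->
  {ae mu, forall x, P x} -> {ae mu, forall x, P (x + t)}.
Proof.
move=> t0 /ae_RplusP /(ae_shift t) H; apply/ae_RplusP.
by apply: ae_sub H => x Px x0; apply: Px; rewrite addr_ge0.
Qed.

Lemma ge0_integral_Rplus (f : mT -> \bar R) :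
  measurable_fun setT f -> (forall x, 0 <= f x)%E ->
  (\int[mu]_x f x = \int[lam]_(x in `[0%R, +oo[) f x)%E.
Proof.
move=> mf f0.
have mN : measurable (`]-oo, 0%R[%classic : set mT) by exact: measurable_itv.
rewrite (@ge0_negligible_integral _ _ _ mu setT `]-oo, 0%R[%classic)//; last first.
  rewrite /Rplus_measure/= /mrestr (_ : `]-oo, 0[%classic `&` _ = set0) ?measure0//.
  apply/seteqP; split => // x [] /=; rewrite !in_itv/= andbT => x0.
  by rewrite leNgt x0.
rewrite (_ : _ `\` _ = `[0%R, +oo[%classic); last first.
  by rewrite setTD setCitvl.
apply: eq_measure_integral => A mA AS.
by rewrite /Rplus_measure/= /mrestr; congr (lam _); exact/setIidPl.
Qed.

Lemma ge0_integral_Rplus_shift (t : R) (f : mT -> \bar R) : 0 <= t ->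
  measurable_fun setT f -> (forall x, 0 <= f x)%E ->
  (\int[mu]_x f (x + t)%R = \int[lam]_(x in `[t, +oo[) f x)%E.
Proof.
move=> t0 mf f0; rewrite ge0_integral_Rplus//; last first.
  exact: (measurableT_comp mf (measurable_shift t)).
rewrite [RHS](ge0_integral_shift t)//; last exact: measurable_funS mf.
congr (integral _ _ _); apply/seteqP.
by split=> x /=; rewrite !in_itv/= !andbT lerDr.
Qed.

Lemma Rplus_sigma_finite : sigma_finite setT mu.
Proof.
have [F FT Ffin] := @sigma_finiteT _ _ _ lam.
exists F => // i; have [mF Foo] := Ffin i; split => //.
rewrite (le_lt_trans _ Foo)// /Rplus_measure/= /mrestr le_measure// inE//.
exact: measurableI.
Qed.

(** The same measure with its sigma-finiteness bundled, as Tonelli's theorem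
    takes it. *)
Definition Rplus_sfmeasure : {sigma_finite_measure set mT -> \bar R} :=
  HB.pack (Measure.sort mu)
    (Measure_isSigmaFinite.Build _ _ _ (Measure.sort mu) Rplus_sigma_finite).

End half_line.

(** * Lebesgue spaces on the half-line *)

Section Lebesgue_spaces.
Context (R : realType).
Local Notation lam := (@lebesgue_measure R).
Local Notation mT := (measurableTypeR R).
Local Notation mu := (Rplus_measure R).
Local Notation X := (L2_Rplus R).
Local Notation V := (LspaceType mu (leey 1%E)).
Implicit Types (f g : X) (u : V) (h : R -> R).

Lemma L2_norm_sqr f : ((`|f| ^+ 2)%:E = \int[mu]_x (f x ^+ 2)%:E)%E.
Proof.
rewrite -Lnorm2_sqr expr2 EFinM.
have -> : (`|f|%:E = 'N[mu]_2%:E[EFin \o f])%E.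
  rewrite -[ `|f| ]/(Lspace_norm f) /Lspace_norm fineK// ge0_fin_numE ?Lnorm_ge0//.
  exact: Lebesgue_finite.
by [].
Qed.

Lemma L2_norm_sqr_ae f (h : mT -> mT) : measurable_fun setT h ->
  {ae mu, forall x, f x = h x} ->
  ((`|f| ^+ 2)%:E = \int[lam]_(x in `[0%R, +oo[) (h x ^+ 2)%:E)%E.
Proof.
move=> mh fh; have mh2 : measurable_fun [set: mT] (fun x : mT => (h x ^+ 2)%:E).
  exact/measurable_EFinP/measurable_funX.
rewrite L2_norm_sqr -ge0_integral_Rplus//; last by move=> x; rewrite lee_fin sqr_ge0.
apply: ge0_ae_eq_integral => //.
- by apply/measurable_EFinP/measurable_funX; exact: measurable_Lspace.
- by move=> x _; rewrite lee_fin sqr_ge0.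
- by move=> x _; rewrite lee_fin sqr_ge0.
- by apply: ae_sub fh => x ->.
Qed.

Lemma L2_exists h : measurable_fun setT h ->
  (\int[mu]_x (h x ^+ 2)%:E < +oo)%E ->
  exists f : X, {ae mu, forall x, f x = h x}.
Proof.
move=> mh hfin.
have hL : h \in Lfun mu (2%:R)%:E.
  apply/andP; split; rewrite inE//= /finite_norm.
  move: hfin; rewrite -Lnorm2_sqr; apply: contraTT; rewrite -!leNgt !leye_eq.
  by move=> /eqP ->; rewrite mulyy.
by exists (Lspace_of (Lfun_Sub (lee1n 2) hL)); exact: Lspace_ofE.
Qed.

Lemma L2_zeroE : {ae mu, forall x, (0 : X) x = 0}.
Proof. exact: Lspace_zeroE. Qed.

Lemma L2_addE f g : {ae mu, forall x, (f + g) x = f x + g x}.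
Proof. exact: Lspace_addE. Qed.

Lemma L2_scaleE (a : R) f : {ae mu, forall x, (a *: f) x = a * f x}.
Proof. exact: Lspace_scaleE. Qed.

Lemma L2_subE f g : {ae mu, forall x, (f - g) x = f x - g x}.
Proof.
apply: ae_sub2 (L2_addE f (- g)) (Lspace_oppE g) => x -> e.
by rewrite -[(- g : X)]/(Lspace_opp g) e.
Qed.

Lemma Rplus_measure_gt0 : (0 < mu [set: R])%E.
Proof.
rewrite /Rplus_measure/= /mrestr setTI lebesgue_measure_itv/= ltry.
by rewrite oppr0 adde0 lt0y.
Qed.

Lemma Linfty_normE u : (`|u|%:E = ess_sup mu (abse \o (EFin \o u)))%E.
Proof.
rewrite -[ `|u| ]/(Lspace_norm u) /Lspace_norm fineK; last first.
  rewrite ge0_fin_numE ?Lnorm_ge0//; exact: Lebesgue_finite.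
by rewrite unlock Rplus_measure_gt0.
Qed.

Lemma Linfty_norm_ae u : {ae mu, forall x, `|u x| <= `|u|}.
Proof.
apply: ae_sub (ess_sup_ge mu (abse \o (EFin \o u))) => x.
by rewrite -Linfty_normE/= lee_fin.
Qed.

Lemma Linfty_norm_le u M : {ae mu, forall x, `|u x| <= M} -> `|u| <= M.
Proof.
move=> uM; rewrite -lee_fin Linfty_normE; apply/ess_supP.
by apply: ae_sub uM => x; rewrite /= lee_fin.
Qed.

Lemma Linfty_exists h M : measurable_fun setT h ->
  {ae mu, forall x, `|h x| <= M} ->
  exists u : V, {ae mu, forall x, u x = h x}.
Proof.
move=> mh hM.
have hL : h \in Lfun mu +oo%E.
  apply/andP; split; rewrite inE//= /finite_norm unlock Rplus_measure_gt0.
  apply: (@le_lt_trans _ _ M%:E); last exact: ltry.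
  by apply/ess_supP; apply: ae_sub hM => x; rewrite /= lee_fin.
by exists (Lspace_of (Lfun_Sub (leey 1%E) hL)); exact: Lspace_ofE.
Qed.

End Lebesgue_spaces.

(** * Left translation *)

Section left_translation.
Context (R : realType).
Local Notation lam := (@lebesgue_measure R).
Local Notation mT := (measurableTypeR R).
Local Notation mu := (Rplus_measure R).
Local Notation X := (L2_Rplus R).
Implicit Types (f g : X) (t s : R).
Local Notation S := (@left_translation R).

Lemma measurable_L2 f : measurable_fun [set: mT] (f : mT -> R).
Proof. exact: measurable_Lspace. Qed.

Lemma measurable_L2_sqr f : measurable_fun [set: mT] (fun x : mT => (f x ^+ 2)%:E).
Proof. by apply/measurable_EFinP/measurable_funX; exact: measurable_L2. Qed.

Lemma integral_shift_sqr t f : 0 <= t ->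
  (\int[mu]_x (f (x + t)%R ^+ 2)%:E = \int[lam]_(x in `[t, +oo[) (f x ^+ 2)%:E)%E.
Proof.
move=> t0.
rewrite (@ge0_integral_Rplus_shift _ t (fun x => (f x ^+ 2)%:E))//.
  exact: measurable_L2_sqr.
by move=> x; rewrite lee_fin sqr_ge0.
Qed.

Lemma tail_le_norm_sqr t f : 0 <= t ->
  (\int[lam]_(x in `[t, +oo[) (f x ^+ 2)%:E <= (`|f| ^+ 2)%:E)%E.
Proof.
move=> t0; rewrite L2_norm_sqr ge0_integral_Rplus; last 2 first.
- exact: measurable_L2_sqr.
- by move=> x; rewrite lee_fin sqr_ge0.
apply: ge0_subset_integral => //.
- by apply: measurable_funS (measurable_L2_sqr f).
- by move=> x _; rewrite lee_fin sqr_ge0.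
- by move=> x /=; rewrite !in_itv/= !andbT; exact: le_trans.
Qed.

(** The set in which [left_translation] chooses is nonempty: for t >= 0 the
    shift of a square integrable function is square integrable. *)
Lemma left_translationE t f : 0 <= t -> {ae mu, forall x, S t f x = f (x + t)}.
Proof.
move=> t0; rewrite /left_translation; case: xgetP => // H.
have : measurable_fun [set: mT] (fun x : mT => f (x + t)).
  exact: (measurableT_comp (measurable_L2 f) (measurable_shift t)).
move=> /L2_exists []; last by move=> g /H.
by rewrite integral_shift_sqr// (le_lt_trans (tail_le_norm_sqr _ _))// ltry.
Qed.

Lemma left_translation_norm_sqr t f : 0 <= t ->
  ((`|S t f| ^+ 2)%:E = \int[lam]_(x in `[t, +oo[) (f x ^+ 2)%:E)%E.
Proof.
move=> t0; rewrite (L2_norm_sqr_ae _ (left_translationE f t0)); last first.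
  exact: (measurableT_comp (measurable_L2 f) (measurable_shift t)).
rewrite -integral_shift_sqr// ge0_integral_Rplus//.
- exact: (measurableT_comp (measurable_L2_sqr f) (measurable_shift t)).
- by move=> x; rewrite lee_fin sqr_ge0.
Qed.

Lemma left_translation_norm_le t f : 0 <= t -> `|S t f| <= `|f|.
Proof.
move=> t0; rewrite -(@ler_pXn2r _ 2) ?nnegrE// -lee_fin left_translation_norm_sqr//.
exact: tail_le_norm_sqr.
Qed.

Lemma left_translation0 f : S 0 f = f.
Proof.
apply/Lspace_eqP; apply: ae_sub (left_translationE f (lexx 0)) => x ->.
by rewrite addr0.
Qed.

Lemma left_translationA t s f : 0 <= t -> 0 <= s -> S t (S s f) = S (t + s) f.
Proof.
move=> t0 s0; apply/Lspace_eqP.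
apply: (ae_mp (left_translationE (S s f) t0)).
apply: (ae_mp (left_translationE f (addr_ge0 t0 s0))).
apply: (ae_mp (ae_Rplus_shift t0 (left_translationE f s0))).
by apply: aeW => x -> -> ->; rewrite addrA.
Qed.

Lemma left_translationB t f g : 0 <= t -> S t (f - g) = S t f - S t g.
Proof.
move=> t0; apply/Lspace_eqP.
apply: (ae_mp (left_translationE (f - g) t0)).
apply: (ae_mp (ae_Rplus_shift t0 (L2_subE f g))).
apply: (ae_mp (left_translationE f t0)); apply: (ae_mp (left_translationE g t0)).
by apply: (ae_mp (L2_subE (S t f) (S t g))); apply: aeW => x -> -> -> ->.
Qed.

Lemma left_translationD t f g : 0 <= t -> S t (f + g) = S t f + S t g.
Proof.
move=> t0; apply/Lspace_eqP.
apply: (ae_mp (left_translationE (f + g) t0)).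
apply: (ae_mp (ae_Rplus_shift t0 (L2_addE f g))).
apply: (ae_mp (left_translationE f t0)); apply: (ae_mp (left_translationE g t0)).
by apply: (ae_mp (L2_addE (S t f) (S t g))); apply: aeW => x -> -> -> ->.
Qed.

Lemma left_translationZ t (a : R) f : 0 <= t -> S t (a *: f) = a *: S t f.
Proof.
move=> t0; apply/Lspace_eqP.
apply: (ae_mp (left_translationE (a *: f) t0)).
apply: (ae_mp (ae_Rplus_shift t0 (L2_scaleE a f))).
apply: (ae_mp (left_translationE f t0)).
by apply: (ae_mp (L2_scaleE a (S t f))); apply: aeW => x -> -> ->.
Qed.

End left_translation.

(** * Strong stability and strong continuity of left translation *)

Section translation_continuity.
Context (R : realType).
Local Notation lam := (@lebesgue_measure R).
Local Notation mT := (measurableTypeR R).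

Lemma lebesgue_measure_segment0 (t : R) : 0 <= t -> lam `[0, t]%classic = t%:E.
Proof.
move=> t0; rewrite lebesgue_measure_itv/= lte_fin oppr0 adde0.
by case: ltgtP t0 => // <-.
Qed.

Lemma integral_cst_segment0 (t c : R) : 0 <= t ->
  (\int[lam]_(x in `[0%R, t]) c%:E = (c * t)%:E)%E.
Proof.
move=> t0; rewrite integral_cst//.
by rewrite -[X in (_ * X)%E]/(lam `[0, t]%classic) lebesgue_measure_segment0.
Qed.

(** Heine-Cantor: (x, h) |-> g(x + h) - g(x) is continuous and vanishes for
    h = 0, and a compact set turns pointwise neighborhoods of h = 0 into a
    uniform one. *)
Lemma compact_uniform_shift (K : set R) (g : R -> R) (e : R) :
  compact K -> continuous g -> 0 < e ->
  \forall h \near 0, forall x, K x -> `|g (x + h) - g x| < e.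
Proof.
move=> /compact_near_coveringP cK cg e0.
apply: (cK R (nbhs 0) (fun h x => `|g (x + h) - g x| < e)) => x Kx.
have : (fun z : R * R => g (z.1 + z.2) - g z.1) @ (x, 0 : R) --> g (x + 0) - g x.
  have c1 : {for (x, 0 : R), continuous (fun z : R * R => z.1)} by exact: cvg_fst.
  have c2 : {for (x, 0 : R), continuous (fun z : R * R => z.2)} by exact: cvg_snd.
  apply: cvgB; last exact: (continuous_comp c1 (cg _)).
  exact: (continuous_comp (continuousD c1 c2) (cg _)).
rewrite addr0 subrr => /cvgr0Pnorm_lt /(_ e e0).
by [].
Qed.

(** Approximate k in L1 by a continuous g: the increment of k is the increment
    of g, uniformly small, up to two approximation errors.  The interval
    [0, N + 1] leaves room for shifts by h <= 1. *)
Lemma translation_L1 (k : R -> R) (N e : R) : 0 <= N -> 0 < e ->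
  measurable_fun [set: mT] (k : mT -> mT) ->
  lam.-integrable `[0, N + 1] (EFin \o k) ->
  exists2 delta : R, 0 < delta & forall h : R, 0 <= h <= delta ->
    (\int[lam]_(x in `[0%R, N]) `|(k (x + h) - k x)%:E| <= e%:E)%E.
Proof.
move=> N0 e0 mk ik.
have e30 : 0 < e / 3 by rewrite divr_gt0.
have Efin : (lam `[0%R, (N + 1)%R] < +oo)%E.
  by rewrite lebesgue_measure_itv/=; case: ifPn => // _; rewrite -EFinB ltry.
have [g_ [cg ig kg]] := approximation_continuous_integrable (measurable_itv _) Efin ik.
have [n kgn] : exists n, (\int[lam]_(x in `[0%R, (N + 1)%R]) `|(k x - g_ n x)%:E| <= (e / 3)%:E)%E.
  have e30' : (0%E < (e / 3)%:E)%E by rewrite lte_fin.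
  have [n _ Hn] := kg _ (open_ereal_lt' e30').
  by exists n; apply/ltW/Hn => /=.
pose g := g_ n.
have mg : measurable_fun [set: mT] (g : mT -> mT).
  by move=> mTT Y mY; exact: (continuous_measurable_fun (cg n) mTT mY).
have e3N : 0 < e / 3 / (N + 1) by rewrite divr_gt0// ltr_wpDl.
have [d /= d0 Hd] := compact_uniform_shift (@segment_compact R 0 (N + 1)) (cg n) e3N.
exists (Num.min (d / 2) 1); first by rewrite lt_min ltr01 divr_gt0.
move=> h /andP[h0]; rewrite le_min => /andP[hd h1].
have gh x : 0 <= x <= N + 1 -> `|g (x + h) - g x| <= e / 3 / (N + 1).
  move=> xN; apply/ltW/Hd; last by rewrite /= in_itv.
  by rewrite /= sub0r normrN ger0_norm// (le_lt_trans hd)// ltr_pdivrMr// ltr_pMr// ltr1n.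
have mk' : measurable_fun [set: mT] (fun x : mT => k (x + h)).
  exact: (measurableT_comp mk (measurable_shift h)).
have mg' : measurable_fun [set: mT] (fun x : mT => g (x + h)).
  exact: (measurableT_comp mg (measurable_shift h)).
have mB (p q : R -> R) (D : set R) : measurable_fun [set: mT] (p : mT -> mT) ->
    measurable_fun [set: mT] (q : mT -> mT) ->
    measurable_fun (D : set mT) (fun x : mT => `|(p x - q x)%:E|%E).
  move=> mp mq; apply: (@measurable_funS _ _ _ _ setT) => //.
  apply: measurableT_comp => //; apply/measurable_EFinP; exact: measurable_funB.
apply: (@le_trans _ _ (\int[lam]_(x in `[0%R, N])
   (`|(k (x + h) - g (x + h))%R%:E| + (`|(g (x + h) - g x)%R%:E| + `|(k x - g x)%R%:E|)))%E).
  apply: ge0_le_integral => //.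
  - exact: mB.
  - by apply: emeasurable_funD; [exact: mB|apply: emeasurable_funD; exact: mB].
  - move=> x _ /=; rewrite -!EFinD lee_fin.
    rewrite (_ : k (x + h) - k x = (k (x + h) - g (x + h)) + ((g (x + h) - g x) - (k x - g x))).
      by rewrite (le_trans (ler_normD _ _))// lerD2l (le_trans (ler_normB _ _)).
    by rewrite opprB !addrA subrK addrC !addrA addrNK addrC.
rewrite ge0_integralD//; last 3 first.
- exact: mB.
- by move=> x _; exact: adde_ge0.
- by apply: emeasurable_funD; exact: mB.
rewrite ge0_integralD//; [|exact: mB|exact: mB].
have -> : e%:E = ((e / 3)%:E + ((e / 3)%:E + (e / 3)%:E))%E.
  by rewrite -!EFinD; congr EFin; rewrite [LHS](splitr e); lra.
apply: leeD; last apply: leeD.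
- apply: le_trans kgn.
  rewrite [X in (_ <= X)%E](ge0_integral_shift h)//; last exact: mB.
  apply: ge0_subset_integral => //.
  + by rewrite -[X in measurable X]setTI; exact: measurable_shift.
  + exact: mB.
  + move=> x /=; rewrite !in_itv/= => /andP[x0 xN].
    by rewrite addr_ge0//= lerD.
- apply: (@le_trans _ _ (\int[lam]_(x in `[0%R, N]) (e / 3 / (N + 1))%:E)%E).
    apply: ge0_le_integral => //.
    + exact: mB.
    + move=> x /=; rewrite in_itv/= => /andP[x0 xN].
      by rewrite /= lee_fin gh// x0 (le_trans xN)// lerDl.
  rewrite integral_cst_segment0// lee_fin mulrAC ler_pdivrMr ?ltr_wpDl//.
  by rewrite ler_pM2l// lerDl.
- apply: le_trans kgn; apply: ge0_subset_integral => //; first exact: mB.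
  move=> x /=; rewrite !in_itv/= => /andP[-> xN]/=.
  by rewrite (le_trans xN)// lerDl.
Qed.


End translation_continuity.

Section left_translation_continuity.
Context (R : realType).
Local Notation lam := (@lebesgue_measure R).
Local Notation mT := (measurableTypeR R).
Local Notation mu := (Rplus_measure R).
Local Notation X := (L2_Rplus R).
Implicit Types (f g : X) (t s : R).
Local Notation S := (@left_translation R).

(** The integrals of f^2 over F n increase to the finite integral over the
    half-line. *)
Lemma L2_exhaustion f (F : nat -> set mT) (e : R) : 0 < e ->
  nondecreasing_seq F -> (forall n, measurable (F n)) ->
  \bigcup_n F n = `[0, +oo[%classic ->
  exists n, (\int[lam]_(x in `[0%R, +oo[ `\` F n) (f x ^+ 2)%:E <= e%:E)%E.
Proof.
move=> e0 ndF mF UF; set q := fun x : R => (f x ^+ 2)%:E.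
have q0 x : (0 <= q x)%E by rewrite lee_fin sqr_ge0.
have mq D : measurable_fun (D : set mT) q by exact: measurable_funS (measurable_L2_sqr f).
have := @ge0_nondecreasing_set_cvg_integral _ mT R F q lam ndF mF (fun i => mq (F i))
  (fun i x _ => q0 x).
have If : (\int[lam]_(x in `[0%R, +oo[) q x = (`|f| ^+ 2)%:E)%E.
  by rewrite L2_norm_sqr ge0_integral_Rplus//; exact: (mq setT).
rewrite UF If => cvgF.
have e0' : ((`|f| ^+ 2 - e)%:E < (`|f| ^+ 2)%:E)%E by rewrite lte_fin gtrBl.
have [n _ Hn] := cvgF _ (open_ereal_gt' e0').
exists n.
have := Hn n (leqnn n) => /= {}Hn.
have FU : F n `<=` `[0, +oo[ by rewrite -UF; exact: bigcup_sup.
have E : (\int[lam]_(x in F n) q x + \int[lam]_(x in `[0%R, +oo[ `\` F n) q x =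
    (`|f| ^+ 2)%:E)%E.
  rewrite -If -[in RHS](setDUK FU) ge0_integral_setU//.
  - by apply: measurableD.
  - by apply/disj_setPS => x [Fx []].
have F1 : (\int[lam]_(x in F n) q x)%E \is a fin_num.
  rewrite ge0_fin_numE ?integral_ge0// (le_lt_trans _ (ltry (`|f| ^+ 2)))//.
  by rewrite -E leeDl// integral_ge0.
move: E => /(congr1 (fun y => y - \int[lam]_(x in F n) q x)%E).
rewrite /= addeAC subee// add0e => ->.
by rewrite leeBlDr// addeC -leeBlDr// -EFinB ltW.
Qed.

(** The squared norm of S t f is the integral of f^2 over [t, +oo[. *)
Lemma left_translation_cvg0 f (e : R) : 0 < e ->
  exists2 T : R, 0 <= T & forall t : R, T <= t -> `|S t f| <= e.
Proof.
move=> e0.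
have [||||n Hn] := @L2_exhaustion f (fun n => `[0, n%:R[%classic) (e ^+ 2).
- by rewrite exprn_gt0.
- move=> m n mn; apply/subsetPset => x /=; rewrite !in_itv/= => /andP[-> xm]/=.
  by rewrite (lt_le_trans xm)// ler_nat.
- by move=> n; exact: measurable_itv.
- apply/seteqP; split => [x [n _]|x]; rewrite /= !in_itv/= ?andbT.
    by case/andP.
  move=> x0; exists (Num.truncn x).+1 => //=.
  by rewrite in_itv/= x0 truncnS_gt.
exists n%:R => // t nt.
have t0 : 0 <= t by rewrite (le_trans _ nt).
rewrite -(@ler_pXn2r _ 2) ?nnegrE//; last exact: ltW.
rewrite -lee_fin left_translation_norm_sqr//; apply: le_trans Hn.
apply: ge0_subset_integral => //.
- exact: measurableD.
- by apply: measurable_funS (measurable_L2_sqr f).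
- by move=> x _; rewrite lee_fin sqr_ge0.
- move=> x /=; rewrite !in_itv/= !andbT => tx; split; first exact: le_trans tx.
  by rewrite (le_trans t0 tx)/= => /(le_lt_trans (le_trans nt tx)); rewrite ltxx.
Qed.

(** Up to an error e / 3, f may be replaced by a truncation c that is bounded
    by n and vanishes outside [0, n]; S h is a contraction, so the error does
    not grow.  For c, the squared increment is at most 2 (n + 1) times the
    increment, and continuity of translations in L1 applies. *)
Lemma left_translation_cvg f (e : R) : 0 < e ->
  exists2 d : R, 0 < d & forall h : R, 0 <= h <= d -> `|S h f - f| <= e.
Proof.
move=> e0; have e30 : 0 < e / 3 by rewrite divr_gt0.
pose F n : set mT := `[0, n%:R]%classic `&` [set x | `|f x| <= n%:R].
have mF n : measurable (F n).
  apply: measurableI => //.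
  have mfn : measurable_fun [set: mT] (fun x : mT => `|f x| : mT).
    by apply: measurableT_comp => //; exact: measurable_L2.
  have := mfn measurableT `]-oo, n%:R]%classic (measurable_itv _).
  by rewrite setTI; congr (measurable _); apply/seteqP; split => x /=; rewrite in_itv.
have [||||n Hn] := @L2_exhaustion f F ((e / 3) ^+ 2).
- by rewrite exprn_gt0.
- move=> m n mn; apply/subsetPset => x [/=]; rewrite !in_itv/= => /andP[x0 xm] fm.
  split => /=; first by rewrite in_itv/= x0 (le_trans xm) ?ler_nat.
  by rewrite (le_trans fm) ?ler_nat.
- exact: mF.
- apply/seteqP; split => [x [n _] []|x]; rewrite /= !in_itv/= ?andbT.
    by case/andP.
  move=> x0; exists (maxn (Num.truncn x).+1 (Num.truncn `|f x|).+1) => //=; split => /=.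
    by rewrite in_itv/= x0 (le_trans (ltW (truncnS_gt _)))// ler_nat leq_maxl.
  by rewrite (le_trans (ltW (truncnS_gt _)))// ler_nat leq_maxr.
pose k (x : R) : R := f x * \1_(F n) x.
have mk : measurable_fun [set: mT] (k : mT -> mT).
  by apply: measurable_funM; [exact: measurable_L2|exact: measurable_indic].
have mk' h : measurable_fun [set: mT] (fun x : mT => (k (x + h) : mT)).
  exact: (measurableT_comp mk (measurable_shift h)).
have msqr (p : R -> R) (D : set R) : measurable_fun [set: mT] (p : mT -> mT) ->
    measurable_fun (D : set mT) (fun x : mT => (p x ^+ 2)%:E).
  by move=> mp; apply: (@measurable_funS _ _ _ _ setT) => //;
    apply/measurable_EFinP/measurable_funX.
have sqr0 (p : R -> R) x : (0 <= (p x ^+ 2)%:E)%E by rewrite lee_fin sqr_ge0.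
have kn x : `|k x| <= n%:R.
  rewrite /k indicE; case: (boolP (x \in F n)) => [/set_mem[_ fx]|_].
    by rewrite mulr1.
  by rewrite mulr0 normr0.
have k0 x : n%:R < x -> k x = 0.
  rewrite /k indicE; case: (boolP (x \in F n)) => [/set_mem[]|_ _].
    by rewrite /= in_itv/= => /andP[_ xn] _; rewrite ltNge xn.
  by rewrite mulr0.
have [c ck] : exists c : X, {ae mu, forall x, c x = k x}.
  apply: L2_exists => //.
  apply: (@le_lt_trans _ _ (\int[mu]_x (f x ^+ 2)%:E)%E); last first.
    by rewrite -L2_norm_sqr ltry.
  apply: ge0_le_integral => //; [exact: msqr|exact: measurable_L2_sqr|].
  move=> x _; rewrite lee_fin /k exprMn ler_piMr ?sqr_ge0// indicE.
have fc : `|f - c| <= e / 3.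
  rewrite -(@ler_pXn2r _ 2) ?nnegrE//; last exact: ltW.
  rewrite -lee_fin (le_trans _ Hn)//.
  have mfk : measurable_fun [set: mT] (fun x : mT => (f x - k x : mT)).
    by apply: measurable_funB => //; exact: measurable_L2.
  rewrite (L2_norm_sqr_ae mfk); last first.
    apply: (ae_mp (L2_subE f c)); apply: (ae_mp ck); apply: aeW => x -> ->.
    by [].
  rewrite setDE integral_mkcondr le_eqVlt; apply/orP; left; apply/eqP.
  apply: eq_integral => x _; rewrite patchE in_setC /k indicE.
  by case: (x \in F n); rewrite ?mulr1 ?mulr0 ?subrr ?subr0 ?expr0n.
pose e' := (e / 3) ^+ 2 / (n.+1%:R *+ 2).
have e'0 : 0 < e' by rewrite divr_gt0// ?exprn_gt0// pmulrn_lgt0.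
have ik : lam.-integrable `[0, n%:R + 1] (EFin \o k).
  apply: measurable_bounded_integrable => //.
  - by rewrite [ltLHS](@lebesgue_measure_segment0 R)// ltry.
  - exact: measurable_funS mk.
  - exists n%:R; split; rewrite ?num_real// => x nx y _ /=.
    by rewrite (le_trans (kn y))// ltW.
have [d d0 Hd] := @translation_L1 R k n%:R e' (ler0n _ _) e'0 mk ik.
exists d => // h hd; have /andP[h0 _] := hd.
have kh : `|S h c - c| <= e / 3.
  rewrite -(@ler_pXn2r _ 2) ?nnegrE//; last exact: ltW.
  rewrite -lee_fin.
  have mkk : measurable_fun [set: mT] (fun x : mT => (k (x + h) - k x : mT)).
    by apply: measurable_funB => //; exact: mk'.
  rewrite (L2_norm_sqr_ae mkk); last first.
    apply: (ae_mp (L2_subE (S h c) c)); apply: (ae_mp ck).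
    apply: (ae_mp (left_translationE c h0)); apply: (ae_mp (ae_Rplus_shift h0 ck)).
    by apply: aeW => x -> -> -> ->.
  have -> : (\int[lam]_(x in `[0%R, +oo[) ((k (x + h) - k x) ^+ 2)%:E =
      \int[lam]_(x in `[0%R, n%:R]) ((k (x + h) - k x) ^+ 2)%:E)%E.
    rewrite [LHS]integral_mkcond [RHS]integral_mkcond; apply: eq_integral => x _.
    rewrite !patchE !mem_setE !in_itv/= andbT.
    have [x0|//] := leP 0 x; have [//|xn] := leP x n%:R.
    by rewrite !k0 ?subrr ?expr0n// ltr_wpDr.
  apply: (@le_trans _ _ (\int[lam]_(x in `[0%R, n%:R])
      ((n.+1%:R *+ 2)%:E * `|(k (x + h) - k x)%:E|))%E).
    apply: ge0_le_integral => //.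
    + exact: (msqr (fun x => k (x + h) - k x)).
    + apply: emeasurable_funM => //; apply: measurableT_comp => //.
      by apply/measurable_EFinP; exact: measurable_funS mkk.
    + move=> x _; rewrite /= lee_fin -real_normK ?num_real// expr2 ler_wpM2r//.
      rewrite (le_trans (ler_normB _ _))// mulr2n lerD//.
        by rewrite (le_trans (kn _))// ler_nat.
      by rewrite (le_trans (kn _))// ler_nat.
  rewrite ge0_integralZl_EFin//; last first.
    apply: measurableT_comp => //.
    by apply/measurable_EFinP; exact: measurable_funS mkk.
  apply: (@le_trans _ _ ((n.+1%:R *+ 2)%:E * e'%:E)%E).
    by apply: lee_wpmul2l; [rewrite lee_fin mulrn_wge0|exact: Hd].
  by rewrite -EFinM lee_fin /e' mulrC mulfVK// gt_eqF// pmulrn_lgt0.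
have -> : S h f - f = S h (f - c) + (S h c - c) - (f - c).
  by rewrite left_translationB// opprB !addrA !subrK.
have -> : e = e / 3 + e / 3 + e / 3 by lra.
apply: (le_trans (ler_normB _ _)); apply: lerD => //.
apply: (le_trans (ler_normD _ _)); apply: lerD => //.
exact: (le_trans (left_translation_norm_le _ h0)).
Qed.


End left_translation_continuity.


(** * Vector-valued functions given by kernels *)

Section kernels.
Context (R : realType).
Local Notation lam := (@lebesgue_measure R).
Local Notation mT := (measurableTypeR R).
Local Notation mu := (Rplus_measure R).
Local Notation mu' := (Rplus_sfmeasure R).
Local Notation X := (L2_Rplus R).
Variable D : set mT.
Hypotheses (mD : measurable D) (Doo : (lam D < +oo)%E).

(** A jointly measurable choice of representatives of the values of f on D,
    which makes Tonelli's theorem available. *)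
Definition kernel_of (f : R -> X) (F : mT * mT -> R) : Prop :=
  measurable_fun setT F /\ forall s, D s -> {ae mu, forall x, f s x = F (s, x)}.

Definition kernel_integral (F : mT * mT -> R) (x : R) : R :=
  \int[lam]_(s in D) F (s, x).

Implicit Types (f g : R -> X) (F G : mT * mT -> R).

Lemma kernel_ofB f g F G : kernel_of f F -> kernel_of g G ->
  kernel_of (fun s => f s - g s) (F \- G).
Proof.
move=> [mF fF] [mG gG]; split; first exact: measurable_funB.
move=> s Ds; apply: (ae_mp (L2_subE (f s) (g s))).
by apply: (ae_mp (fF s Ds)); apply: (ae_mp (gG s Ds)); apply: aeW => x -> -> ->.
Qed.

Lemma kernel_norm_sqr f F s : kernel_of f F -> D s ->
  ((`|f s| ^+ 2)%:E = \int[mu']_x (F (s, x) ^+ 2)%:E)%E.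
Proof.
move=> [mF fF] Ds.
have mFs : measurable_fun [set: mT] (fun x : mT => F (s, x) : mT).
  exact: (measurable_fun_pair2 s mF).
rewrite (L2_norm_sqr_ae mFs (fF s Ds)) -ge0_integral_Rplus//.
- exact/measurable_EFinP/measurable_funX.
- by move=> x; rewrite lee_fin sqr_ge0.
Qed.

(** By Tonelli, the integral of F(s, .)^2 depends measurably on s. *)
Lemma measurable_kernel_norm f F : kernel_of f F ->
  measurable_fun D (fun s => `|f s|).
Proof.
move=> kF; have [mF _] := kF.
pose n2 s := (\int[mu']_x (F (s, x) ^+ 2)%:E)%E.
have mn2 : measurable_fun [set: mT] n2.
  apply: (measurable_fun_fubini_tonelli_F (fun z => (F z ^+ 2)%:E)).
  - exact/measurable_EFinP/measurable_funX.
  - by move=> x; rewrite lee_fin sqr_ge0.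
apply: (@eq_measurable_fun _ _ _ _ D (fun s => fine (n2 s) `^ 2^-1)).
  move=> s /set_mem Ds.
  rewrite /n2 -(kernel_norm_sqr kF Ds)/= powR12_sqrt ?sqr_ge0//.
  by rewrite sqrtr_sqr ger0_norm.
apply: (@measurable_funS _ _ _ _ setT) => //.
apply: (measurableT_comp (measurable_powR _)).
exact: measurableT_comp.
Qed.

Lemma kernel_minkowski f F (W : R) : kernel_of f F ->
  (\int[lam]_(s in D) `|f s|%:E <= W%:E)%E ->
  (\int[mu']_x ((\int[lam]_(s in D) `|(F (s, x))%:E|) *
     (\int[lam]_(s in D) `|(F (s, x))%:E|)) <= (W ^+ 2)%:E)%E.
Proof.
move=> kF fW.
apply: (@minkowski_integral _ _ _ _ _ lam mu' D F (fun s => `|f s|)) => //.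
- exact: kF.1.
- exact: measurable_kernel_norm kF.
- by move=> s Ds; rewrite -(kernel_norm_sqr kF Ds).
Qed.

Let restr_prod F (z : mT * mT) : R := (\1_D z.1 * F z)%R.

Let measurable_restr_prod F : measurable_fun setT F -> measurable_fun setT (restr_prod F).
Proof.
move=> mF; apply: measurable_funM => //.
by apply: (measurableT_comp (measurable_indic mD)); exact: measurable_fst.
Qed.

Lemma measurable_kernel_section_abs F : measurable_fun setT F ->
  measurable_fun [set: mT] (fun x => \int[lam]_(s in D) `|(F (s, x))%:E|)%E.
Proof.
move=> mF; rewrite (_ : (fun _ => _) =
    (fun x => \int[lam]_s `|(restr_prod F (s, x))%:E|)%E); last first.
  apply/funext => x; rewrite integral_mkcond; apply: eq_integral => s _.
  rewrite patchE /restr_prod indicE/=; case: ifPn => sD; first by rewrite mul1r.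
  by rewrite mul0r normr0.
apply: (measurable_fun_fubini_tonelli_G (fun z => `|(restr_prod F z)%:E|)%E) => //.
apply: measurableT_comp => //; apply/measurable_EFinP.
exact: measurable_restr_prod.
Qed.

Lemma measurable_kernel_integral F : measurable_fun setT F ->
  measurable_fun [set: mT] (kernel_integral F).
Proof.
move=> mF; apply: measurableT_comp => //.
rewrite (_ : (fun _ => _) =
    (fun x => \int[lam]_s ((EFin \o restr_prod F)^\+ (s, x)) -
       \int[lam]_s ((EFin \o restr_prod F)^\- (s, x)))%E); last first.
  apply/funext => x; rewrite integral_mkcond integralE; congr (_ - _)%E.
    apply: eq_integral => s _.
    rewrite !funeposE/= patchE /restr_prod indicE/=; case: ifPn => sD.
      by rewrite mul1r.
    by rewrite mul0r.
  apply: eq_integral => s _.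
  rewrite !funenegE/= patchE /restr_prod indicE/=; case: ifPn => sD.
    by rewrite mul1r.
  by rewrite mul0r.
have mr : measurable_fun setT (EFin \o restr_prod F).
  apply/measurable_EFinP; exact: measurable_restr_prod.
apply: emeasurable_funB.
- apply: (measurable_fun_fubini_tonelli_G ((EFin \o restr_prod F)^\+)%E) => //.
  exact: measurable_funepos.
- apply: (measurable_fun_fubini_tonelli_G ((EFin \o restr_prod F)^\-)%E) => //.
  exact: measurable_funeneg.
Qed.

(** By Minkowski's inequality x |-> int_D |F(s, x)| ds is square integrable;
    in particular it is finite almost everywhere. *)
Lemma kernel_integral_L2 f F (W : R) : kernel_of f F ->
  (\int[lam]_(s in D) `|f s|%:E <= W%:E)%E ->
  exists I : X, [/\ {ae mu, forall x, I x = kernel_integral F x}, `|I| <= W &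
    {ae mu, forall x, lam.-integrable D (fun s => (F (s, x))%:E)}].
Proof.
move=> kF fW; have [mF _] := kF.
have W0 : 0 <= W by rewrite -lee_fin (le_trans _ fW)// integral_ge0.
pose A x := (\int[lam]_(s in D) `|(F (s, x))%:E|)%E.
have mA : measurable_fun [set: mT] A by exact: measurable_kernel_section_abs.
have A0 x : (0 <= A x)%E by exact: integral_ge0.
have AW : (\int[mu]_x (A x * A x) <= (W ^+ 2)%:E)%E by exact: kernel_minkowski kF fW.
have mFx x : measurable_fun D (fun s => (F (s, x))%:E).
  apply: (@measurable_funS _ _ _ _ setT) => //.
  by apply/measurable_EFinP; exact: measurable_fun_pair1.
have Afin : {ae mu, forall x, A x \is a fin_num}.
  have : mu.-integrable setT (fun x => A x * A x)%E.
    apply/integrableP; split; first exact: emeasurable_funM.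
    rewrite (eq_integral (fun x => A x * A x)%E) ?(le_lt_trans AW) ?ltry//.
    by move=> x _; rewrite gee0_abs// mule_ge0.
  move=> /(integrable_ae measurableT); apply: ae_sub => x /(_ Logic.I).
  rewrite ge0_fin_numE ?mule_ge0// ge0_fin_numE//.
  apply: contraTT; rewrite -!leNgt !leye_eq => /eqP ->; by rewrite mulyy.
have Fint : {ae mu, forall x, lam.-integrable D (fun s => (F (s, x))%:E)}.
  apply: ae_sub Afin => x; rewrite ge0_fin_numE// => Ax.
  exact/integrableP.
have IA : {ae mu, forall x, ((kernel_integral F x ^+ 2)%:E <= A x * A x)%E}.
  apply: (ae_mp Fint); apply: (ae_mp Afin); apply: aeW => x /fineK <- iF.
  rewrite -EFinM lee_fin -real_normK ?num_real// -expr2 lerXn2r ?nnegrE// ?fine_ge0//.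
  exact: le_normr_Rintegral.
have mI := measurable_kernel_integral mF.
have IW : (\int[mu]_x (kernel_integral F x ^+ 2)%:E <= (W ^+ 2)%:E)%E.
  apply: le_trans AW; apply: ae_ge0_le_integral => //.
  - by move=> x _; rewrite lee_fin sqr_ge0.
  - exact/measurable_EFinP/measurable_funX.
  - by move=> x _; rewrite mule_ge0.
  - exact: emeasurable_funM.
  - by apply: ae_sub IA.
have [I EI] := L2_exists mI (le_lt_trans IW (ltry _)).
exists I; split => //.
rewrite -(@ler_pXn2r _ 2) ?nnegrE// -lee_fin; apply: le_trans IW.
rewrite (L2_norm_sqr_ae mI EI) ge0_integral_Rplus//.
- exact/measurable_EFinP/measurable_funX.
- by move=> x; rewrite lee_fin sqr_ge0.
Qed.

End kernels.

(** * Bochner integrals of functions given by kernels *)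

Section bochner_kernels.
Context (R : realType).
Local Notation lam := (@lebesgue_measure R).
Local Notation mT := (measurableTypeR R).
Local Notation mu := (Rplus_measure R).
Local Notation X := (L2_Rplus R).
Variable D : set mT.
Hypotheses (mD : measurable D) (Doo : (lam D < +oo)%E).
Implicit Types (f g h : mT -> X) (F G : mT * mT -> R).

Lemma L2_sumE (r : seq X) (a : X -> R) :
  {ae mu, forall x, (\sum_(y <- r) a y *: y) x = \sum_(y <- r) a y * y x}.
Proof.
elim: r => [|y r IH].
  by rewrite big_nil; apply: ae_sub (L2_zeroE R) => x ->; rewrite big_nil.
rewrite big_cons; apply: (ae_mp (L2_addE (a y *: y) (\sum_(y <- r) a y *: y))).
apply: (ae_mp (L2_scaleE (a y) y)); apply: (ae_mp IH).
by apply: aeW => x -> -> ->; rewrite big_cons.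
Qed.

(** The kernel is the sum over the values y of h of 1_(h = y)(s) y(x). *)
Lemma simple_kernel h : integrable_simple lam D h ->
  exists H, [/\ kernel_of D h H,
    (forall x, lam.-integrable D (fun s => (H (s, x))%:E)) &
    {ae mu, forall x, simple_integral lam D h x = kernel_integral D H x}].
Proof.
move=> [fh mh _]; pose r : seq X := enum_fset (fset_set (range h)).
pose H (z : mT * mT) : R := \sum_(y <- r) \1_(h @^-1` [set y]) z.1 * y z.2.
have i1 y : lam.-integrable D (EFin \o \1_(h @^-1` [set y])).
  apply: measurable_bounded_integrable => //.
  exists 1; split; rewrite ?num_real// => M M1 s _ /=.
  by rewrite indicE; case: (_ \in _); rewrite ?normr1 ?normr0 ltW// (lt_trans ltr01).
have iy y (x : R) :
    lam.-integrable D (fun s => (\1_(h @^-1` [set y]) s * y x)%:E).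
  by under eq_fun do rewrite EFinM; apply: integrableZr => //; exact: i1.
have HE (q : seq X) (x : R) :
  lam.-integrable D (fun s => (\sum_(y <- q) \1_(h @^-1` [set y]) s * y x)%:E) /\
  (\int[lam]_(s in D) (\sum_(y <- q) \1_(h @^-1` [set y]) s * y x) =
    \sum_(y <- q) fine (lam (D `&` h @^-1` [set y])) * y x).
  elim: q => [|y q [IH1 IH2]].
    rewrite big_nil; under eq_fun do rewrite big_nil.
    split; first exact: integrable0.
    by under eq_Rintegral do rewrite big_nil; rewrite /Rintegral integral0.
  split.
    under eq_fun do rewrite big_cons EFinD.
    exact: integrableD.
  under eq_Rintegral do rewrite big_cons.
  rewrite big_cons -IH2 [LHS](RintegralD mD (iy y x) IH1); congr (_ + _).
  rewrite [LHS](RintegralZr (y x) mD (i1 y)).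
  congr (_ * _); rewrite /Rintegral integral_indic//.
  by rewrite setIC.
exists H; split.
- split.
  + apply: measurable_sum => y; apply: measurable_funM.
      by apply: (measurableT_comp (measurable_indic (mh y))); exact: measurable_fst.
    by apply: (measurableT_comp (measurable_L2 y)); exact: measurable_snd.
  + move=> s Ds; apply: aeW => x; rewrite /H/=.
    have hr : h s \in fset_set (range h) by rewrite in_fset_set// inE; exists s.
    rewrite (bigD1_seq (h s))//=; last exact: fset_uniq.
    rewrite indicE mem_set//= mul1r big1 ?addr0// => y yh.
    rewrite indicE memNset ?mul0r//= => hy.
    by rewrite hy eqxx in yh.
- by move=> x; have [] := HE r x.
- rewrite /simple_integral fsbig_finite//.
  apply: ae_sub (L2_sumE r (fun y => fine (lam (D `&` h @^-1` [set y])))) => x ->.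
  by rewrite /kernel_integral /H/=; have [_ ->] := HE r x.
Qed.

(** The difference is the integral of the kernel of f - h.  This estimate gives
    both the existence and the uniqueness of the Bochner integral of f. *)
Lemma kernel_simple_bound f F (I : X) h (W : R) : kernel_of D f F ->
  {ae mu, forall x, I x = kernel_integral D F x} ->
  {ae mu, forall x, lam.-integrable D (fun s => (F (s, x))%:E)} ->
  integrable_simple lam D h ->
  (\int[lam]_(s in D) `|f s - h s|%:E <= W%:E)%E ->
  `|I - simple_integral lam D h| <= W.
Proof.
move=> kF EI iF sh fhW.
have [H [kH iH EH]] := simple_kernel sh.
have [J [EJ JW _]] := kernel_integral_L2 mD Doo (kernel_ofB kF kH) fhW.
suff -> : I - simple_integral lam D h = J by [].
apply/Lspace_eqP.
apply: (ae_mp (L2_subE I (simple_integral lam D h))).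
apply: (ae_mp EI); apply: (ae_mp EH); apply: (ae_mp EJ); apply: (ae_mp iF).
apply: aeW => x iFx -> -> -> ->.
exact/esym/(RintegralB mD iFx (iH x)).
Qed.

Lemma simple_integral_cvg f F (I : X) (h_ : nat -> mT -> X) : kernel_of D f F ->
  {ae mu, forall x, I x = kernel_integral D F x} ->
  {ae mu, forall x, lam.-integrable D (fun s => (F (s, x))%:E)} ->
  (forall n, integrable_simple lam D (h_ n)) ->
  (\int[lam]_(s in D) (`|f s - h_ n s|)%:E)%E @[n --> \oo] --> 0%E ->
  simple_integral lam D (h_ n) @[n --> \oo] --> I.
Proof.
move=> kF EI iF sh fh; apply/cvgrPdist_le => e e0.
have e0' : (0%E < e%:E)%E by rewrite lte_fin.
have [n _ Hn] := fh _ (open_ereal_lt' e0').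
exists n => // m nm; apply: (kernel_simple_bound kF EI iF (sh m)).
exact/ltW/(Hn m nm).
Qed.

(** By [simple_integral_cvg] the simple integrals of every approximating sequence
    converge to I, so I is the only Bochner integral of f. *)
Lemma bochner_integral_kernel f F (I : X) (h_ : nat -> mT -> X) : kernel_of D f F ->
  {ae mu, forall x, I x = kernel_integral D F x} ->
  {ae mu, forall x, lam.-integrable D (fun s => (F (s, x))%:E)} ->
  (forall n, integrable_simple lam D (h_ n)) ->
  {ae lam, forall s, D s -> h_ ^~ s @ \oo --> f s} ->
  (\int[lam]_(s in D) (`|f s - h_ n s|)%:E)%E @[n --> \oo] --> 0%E ->
  bochner_integral lam D f = I.
Proof.
move=> kF EI iF sh hf fh; rewrite /bochner_integral.
have bI : is_bochner_integral lam D f I.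
  split; first by exists h_.
  by exists h_; split => //; exact: (simple_integral_cvg kF EI iF sh fh).
case: xgetP => [J _ [_ [g_ [sg fg gJ]]]|/(_ I)//].
apply: (cvg_unique _ gJ (simple_integral_cvg kF EI iF sg fg)).
exact: norm_hausdorff.
Qed.

End bochner_kernels.

(** * The Duhamel integral *)

Section quantization.
Context (R : realType).
Local Notation mT := (measurableTypeR R).
Implicit Types (y : R) (n : nat).

Definition quantize n y : R := (Num.floor (n.+1%:R * y))%:~R / n.+1%:R.

Lemma quantize_le n y : quantize n y <= y.
Proof. by rewrite /quantize ler_pdivrMr// mulrC; exact: floor_le. Qed.

Lemma quantize_ge n y : y - n.+1%:R^-1 <= quantize n y.
Proof.
rewrite /quantize ler_pdivlMr// mulrBl mulVf// mulrC lerBlDr ltW//.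
by have /andP[_] := floor_itv (n.+1%:R * y); rewrite intrD.
Qed.

Lemma quantize_ge0 n y : 0 <= y -> 0 <= quantize n y.
Proof. by move=> y0; rewrite divr_ge0// ler0z floor_ge0 mulr_ge0. Qed.

Lemma measurable_floor_fiber (v : mT -> mT) (c : R) (i : int) :
  measurable_fun setT v ->
  measurable ((fun s => Num.floor (c * v s)) @^-1` [set i] : set mT).
Proof.
move=> mv; have mcv : measurable_fun setT (fun s : mT => (c * v s : mT)).
  exact: measurable_funM.
have := mcv measurableT `[i%:~R, (i + 1)%:~R[%classic (measurable_itv _).
rewrite setTI; congr (measurable _); apply/seteqP; split => s /=; rewrite in_itv/=.
  by move=> /floor_def.
by move=> <-; exact: floor_itv.
Qed.

Lemma finite_floor_range (T : Type) (v : T -> R) (M : R) :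
  (forall s, `|v s| <= M) -> finite_set (range (fun s => Num.floor (v s))).
Proof.
move=> vM; pose K := (Num.truncn M).+1.
apply: (@sub_finite_set _ _ [set (m%:Z - K%:Z)%R | m in `I_(K + K)]).
  move=> _ [s _ <-] /=.
  have MK : M < K%:R by exact: truncnS_gt.
  have := vM s; rewrite ler_norml => /andP[v1 v2].
  have h1 : - K%:Z <= Num.floor (v s).
    by rewrite floor_ge_int intrN (le_trans _ v1)// lerN2 ltW.
  have h2 : Num.floor (v s) < K%:Z by rewrite floor_lt_int (le_lt_trans v2).
  by exists (absz (Num.floor (v s) + K%:Z)); lia.
by apply: finite_image; exact: finite_II.
Qed.

End quantization.

Section duhamel.
Context (R : realType).
Local Notation lam := (@lebesgue_measure R).
Local Notation mT := (measurableTypeR R).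
Local Notation mu := (Rplus_measure R).
Local Notation X := (L2_Rplus R).
Local Notation S := (@left_translation R).

(** The level sets of G \o k are finite unions of level sets of k. *)
Lemma integrable_simple_comp (D : set mT) (I : Type) (k : mT -> I) (G : I -> X) :
  measurable D -> (lam D < +oo)%E ->
  finite_set (range k) -> (forall i, measurable (k @^-1` [set i] : set mT)) ->
  integrable_simple lam D (G \o k).
Proof.
move=> mD Doo fk mk; have mGk y : measurable ((G \o k) @^-1` [set y] : set mT).
  rewrite (_ : _ @^-1` _ =
      \bigcup_(i in range k `&` G @^-1` [set y]) k @^-1` [set i]); last first.
    apply/seteqP; split => s /=.
      by move=> Gks; exists (k s) => //; split => //; exists s.
    by move=> [i [_ Gi] /= ->].
  by apply: fin_bigcup_measurable => //; exact: finite_setIl.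
split => //.
- rewrite (_ : range _ = G @` range k); last by rewrite image_comp.
  exact: finite_image.
- move=> y _; apply: le_lt_trans Doo; rewrite le_measure// inE//.
  exact: measurableI.
Qed.

Lemma scaleB_telescope (V : lmodType R) (a c : R) (x y : V) :
  a *: x - c *: y = (a - c) *: x - c *: (y - x).
Proof. by rewrite scalerBl scalerBr opprB addrA subrK. Qed.

Section approximation.
Variables (t M : R) (u : mT -> mT) (b : X).
Hypotheses (t0 : 0 <= t) (mu_ : measurable_fun setT u).
Hypotheses (uM : forall s, `|u s| <= M).

Let clamp (s : mT) : mT := Num.max 0 (Num.min s t).

(** Time and input value are rounded down to multiples of 1 / (n + 1).  The time
    is first brought into [0, t], so that finitely many values occur and the
    translation S is only taken at nonnegative times. *)
Let step n (s : mT) : X :=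
  quantize n (u s) *: S (t - quantize n (clamp s)) b.

Let clampE s : 0 <= s <= t -> clamp s = s.
Proof. by move=> /andP[s0 st]; rewrite /clamp min_l// max_r. Qed.

Lemma integrable_simple_step n : integrable_simple lam `[0, t] (step n).
Proof.
pose k s := (Num.floor (n.+1%:R * u s), Num.floor (n.+1%:R * clamp s)).
have mclamp : measurable_fun setT clamp.
  by apply: measurable_maxr => //; exact: measurable_minr.
pose G (p : int * int) : X :=
  (p.1%:~R / n.+1%:R) *: S (t - (p.2%:~R / n.+1%:R)) b.
apply: (@integrable_simple_comp _ _ k G) => //.
- by rewrite [ltLHS](lebesgue_measure_segment0 t0) ltry.
- apply: (@sub_finite_set _ _ (range (fun s => Num.floor (n.+1%:R * u s)) `*`
    range (fun s => Num.floor (n.+1%:R * clamp s)))).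
    by move=> _ [s _ <-]; split; exists s.
  apply: finite_setX.
    apply: (@finite_floor_range _ _ _ (n.+1%:R * M)) => s.
    by rewrite normrM ger0_norm// ler_pM2l.
  apply: (@finite_floor_range _ _ _ (n.+1%:R * t)) => s.
  rewrite normrM ger0_norm// ler_pM2l// ger0_norm /clamp ?le_max ?lexx//.
  by rewrite ge_max t0 ge_min lexx orbT.
- move=> [i j].
  rewrite (_ : _ @^-1` _ = (fun s => Num.floor (n.+1%:R * u s)) @^-1` [set i] `&`
      (fun s => Num.floor (n.+1%:R * clamp s)) @^-1` [set j]); last first.
    by apply/seteqP; split => s /=; [case=> -> ->|case=> <- <-].
  by apply: measurableI; exact: measurable_floor_fiber.
Qed.

(** The error of rounding u(s) is multiplied by the norm of b; the error of
    rounding s to p contributes S(t - s)(S(s - p) b - b), which is small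
    by strong continuity at 0, uniformly in s. *)
Lemma step_approx (e : R) : 0 < e -> exists N, forall n s, (N <= n)%N ->
  0 <= s <= t -> `|S (t - s) (u s *: b) - step n s| <= e.
Proof.
move=> e0; have M0 : 0 <= M by exact: le_trans (uM 0).
have e20 : 0 < e / 2 by rewrite divr_gt0.
have e2M : 0 < e / 2 / (M + 1) by rewrite divr_gt0// ltr_wpDl.
have [d d0 Hd] := left_translation_cvg b e2M.
pose K := Num.max d^-1 (Num.max 1 (`|b| / (e / 2))).
exists (Num.truncn K) => n s nK /[dup] st /andP[s0 s1].
have Kn : K < n.+1%:R by rewrite (lt_le_trans (truncnS_gt _))// ler_nat.
have nd : n.+1%:R^-1 <= d.
  by rewrite -(invrK d) lef_pV2 ?posrE ?invr_gt0// (le_trans _ (ltW Kn))// le_max lexx.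
have n1 : n.+1%:R^-1 <= 1 :> R by rewrite invf_le1// ler1n.
have nb : n.+1%:R^-1 * `|b| <= e / 2.
  rewrite mulrC ler_pdivrMr// -ler_pdivrMl// mulrC (le_trans _ (ltW Kn))// !le_max lexx.
  by rewrite !orbT.
rewrite /step (clampE st); set q := quantize n (u s); set p := quantize n s.
have p0 : 0 <= p by exact: quantize_ge0.
have ps : p <= s by exact: quantize_le.
have sp : s - p <= n.+1%:R^-1.
  by rewrite lerBlDr -lerBlDl; exact: quantize_ge.
have qu : `|u s - q| <= n.+1%:R^-1.
  rewrite ger0_norm ?subr_ge0 ?quantize_le//.
  by rewrite lerBlDr -lerBlDl; exact: quantize_ge.
have qM : `|q| <= M + 1.
  rewrite (_ : q = u s - (u s - q)); last by rewrite opprB addrCA subrr addr0.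
  by rewrite (le_trans (ler_normB _ _))// lerD// (le_trans qu).
have ts : 0 <= t - s by rewrite subr_ge0.
clearbody p q.
have -> : S (t - p) b = S (t - s) (S (s - p) b).
  by rewrite left_translationA ?subr_ge0// addrA subrK.
rewrite left_translationZ//.
have -> : u s *: S (t - s) b - q *: S (t - s) (S (s - p) b) =
    (u s - q) *: S (t - s) b - q *: S (t - s) (S (s - p) b - b).
  by rewrite left_translationB//; exact: scaleB_telescope.
have -> : e = e / 2 + e / 2 by rewrite -splitr.
apply: (le_trans (ler_normB _ _)); rewrite !normrZ; apply: lerD.
  rewrite (le_trans _ nb)// ler_pM//; exact: left_translation_norm_le.
apply: (@le_trans _ _ ((M + 1) * (e / 2 / (M + 1)))).
  apply: ler_pM => //; apply: (le_trans (left_translation_norm_le _ ts)).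
  by apply: Hd; rewrite subr_ge0 ps (le_trans sp).
by rewrite mulrC divfK// gt_eqF// ltr_wpDl.
Qed.

End approximation.

Lemma cvge0_of_le (a : nat -> \bar R) : (forall n, (0 <= a n)%E) ->
  (forall e : R, 0 < e -> exists N, forall n, (N <= n)%N -> (a n <= e%:E)%E) ->
  a @ \oo --> 0%E.
Proof.
move=> a0 Ha; apply/fine_cvgP; split.
  have [N HN] := Ha 1 ltr01; exists N => // n Nn.
  by rewrite ge0_fin_numE// (le_lt_trans (HN n Nn))// ltry.
apply/cvgr0Pnorm_le => e e0; have [N HN] := Ha e e0; exists N => // n Nn /=.
have afin : a n \is a fin_num by rewrite ge0_fin_numE// (le_lt_trans (HN n Nn))// ltry.
by rewrite ger0_norm ?fine_ge0// -lee_fin fineK// HN.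
Qed.

(** The kernel is F(s, x) = u(s) b(x + (t - s)).  As u is bounded only almost
    everywhere, the simple approximants are built from its truncation u'; they
    converge uniformly off a null set.  The norm bound holds because left
    translation is a contraction. *)
Lemma duhamel_integral (t M : R) (u : R -> R) (b : X) : 0 <= t ->
  measurable_fun [set: mT] (u : mT -> mT) -> {ae mu, forall s, `|u s| <= M} ->
  let I := bochner_integral lam `[0, t]
    (fun s => S (t - s) (rank_one_operator b (u s))) in
  [/\ {ae mu, forall x, I x = \int[lam]_(s in `[0, t]) (u s * b (x + (t - s)))},
    {ae mu, forall x, lam.-integrable `[0, t] (fun s => (u s * b (x + (t - s)))%:E)} &
    forall W, (\int[lam]_(s in `[0%R, t]) (`|u s| * `|b|)%:E <= W%:E)%E -> `|I| <= W].
Proof.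
move=> t0 mu_ uM I; set D : set mT := `[0, t]%classic.
have mD : measurable D by exact: measurable_itv.
have Doo : (lam D < +oo)%E by rewrite /D (lebesgue_measure_segment0 t0) ltry.
pose f s := S (t - s) (rank_one_operator b (u s)).
pose F (z : mT * mT) : R := u z.1 * b (z.2 + (t - z.1)).
have tsub s : D s -> 0 <= t - s by rewrite /D/= in_itv/= subr_ge0 => /andP[].
have kF : kernel_of D f F.
  split.
    apply: measurable_funM.
      by apply: (measurableT_comp mu_); exact: measurable_fst.
    apply: (measurableT_comp (measurable_L2 b)).
    apply: measurable_funD; first exact: measurable_snd.
    by apply: measurable_funB => //; exact: measurable_fst.
  move=> s Ds; have ts := tsub s Ds.
  apply: (ae_mp (left_translationE (u s *: b) ts)).
  apply: (ae_mp (ae_Rplus_shift ts (L2_scaleE (u s) b))).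
  by apply: aeW => x; rewrite /f /rank_one_operator /F/= => -> ->.
have mf := measurable_kernel_norm kF.
have mub : measurable_fun D (fun s => (`|u s| * `|b|)%:E).
  apply/measurable_EFinP; apply: measurable_funM => //.
  by apply: measurableT_comp => //; exact: measurable_funS mu_.
have fW W : (\int[lam]_(s in D) (`|u s| * `|b|)%:E <= W%:E)%E ->
    (\int[lam]_(s in D) `|f s|%:E <= W%:E)%E.
  apply: le_trans; apply: ge0_le_integral => //; first exact/measurable_EFinP.
  move=> s Ds; rewrite lee_fin -normrZ.
  exact: left_translation_norm_le (tsub s Ds).
have uMlam : {ae lam, forall s, D s -> `|u s| <= M}.
  move/ae_RplusP : uM; apply: ae_sub => s us; rewrite /D/= in_itv/= => /andP[s0 _].
  exact: us.
have ubM : (\int[lam]_(s in D) (`|u s| * `|b|)%:E <= (`|M| * `|b| * t)%:E)%E.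
  rewrite -integral_cst_segment0//; apply: ae_ge0_le_integral => //.
  apply: ae_sub uMlam => s /[apply] us.
  by rewrite lee_fin ler_wpM2r// (le_trans us)// ler_norm.
have [J [EJ _ iF]] := kernel_integral_L2 mD Doo kF (fW _ ubM).
pose u' (s : mT) : mT := Num.max (- `|M|) (Num.min `|M| (u s)).
have u'M s : `|u' s| <= `|M|.
  by rewrite ler_norml /u' le_max lexx/= ge_max ge_min lexx/= andbT (le_trans _ (normr_ge0 M))// oppr_le0.
have mu' : measurable_fun setT u'.
  by apply: measurable_maxr => //; exact: measurable_minr.
have u'E s : `|u s| <= M -> u' s = u s.
  move=> us; have uM' : `|u s| <= `|M| by rewrite (le_trans us)// ler_norm.
  by move: uM'; rewrite ler_norml /u' => /andP[u1 u2]; rewrite min_r// max_r.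
pose h_ n (s : mT) : X :=
  quantize n (u' s) *: S (t - quantize n (Num.max 0 (Num.min s t))) b.
have sh n : integrable_simple lam D (h_ n) by exact: (integrable_simple_step b t0 mu' u'M).
have approx (e : R) : 0 < e -> exists N, forall n, (N <= n)%N ->
    forall s, `|u s| <= M -> D s -> `|f s - h_ n s| <= e.
  move=> e0; have [N HN] := step_approx t b u'M e0.
  exists N => n Nn s us Ds; rewrite /f /rank_one_operator -(u'E s us).
  by apply: HN => //; move: Ds; rewrite /D/= in_itv.
have cvgh : {ae lam, forall s, D s -> h_ ^~ s @ \oo --> f s}.
  apply: ae_sub uMlam => s us Ds; apply/cvgrPdist_le => e e0.
  by have [N HN] := approx e e0; exists N => // n Nn; exact: HN (us Ds) Ds.
have inth : (\int[lam]_(s in D) (`|f s - h_ n s|)%:E)%E @[n --> \oo] --> 0%E.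
  apply: cvge0_of_le => [n|e e0]; first exact: integral_ge0.
  have et0 : 0 < e / (t + 1) by rewrite divr_gt0// ltr_wpDl.
  have [N HN] := approx _ et0; exists N => n Nn.
  apply: (@le_trans _ _ (e / (t + 1) * t)%:E); last first.
    by rewrite lee_fin mulrAC ler_pdivrMr ?ltr_wpDl// ler_pM2l// lerDl.
  rewrite -integral_cst_segment0//; apply: ae_ge0_le_integral => //.
  - have [H [kH _ _]] := simple_kernel mD Doo (sh n).
    by apply/measurable_EFinP; exact: measurable_kernel_norm (kernel_ofB kF kH).
  - by move=> s _; rewrite lee_fin ltW.
  - by apply: ae_sub uMlam => s us Ds; rewrite lee_fin; exact: HN (us Ds) Ds.
have IJ : I = J.
  exact: (bochner_integral_kernel mD Doo kF EJ iF sh cvgh inth).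
rewrite IJ; split => // W uW.
have [J' [EJ' JW _]] := kernel_integral_L2 mD Doo kF (fW _ uW).
suff -> : J = J' by [].
by apply/Lspace_eqP; apply: (ae_mp EJ); apply: (ae_mp EJ'); apply: aeW => x -> ->.
Qed.

End duhamel.


(** * Calculus of the Duhamel integral *)

Section change_of_variable.
Context (R : realType).
Local Notation lam := (@lebesgue_measure R).
Local Notation mT := (measurableTypeR R).
Local Notation mu := (Rplus_measure R).

Lemma ae_Rplus_ge0 : {ae mu, forall x : R, 0 <= x}.
Proof. by apply/ae_RplusP; exact: aeW. Qed.

Lemma measurable_opp : measurable_fun [set: mT] (fun x : mT => (- x : mT)).
Proof. exact: measurable_funN. Qed.

Lemma ge0_integral_opp (D : set mT) (f : R -> \bar R) :
  measurable D -> measurable_fun D f -> (forall x, D x -> (0 <= f x)%E) ->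
  (\int[lam]_(x in D) f x =
   \int[lam]_(x in (fun x : R => - x)%R @^-1` D) f (- x)%R)%E.
Proof.
move=> mD mf f0.
rewrite -(ge0_integral_pushforward measurable_opp lam mD mf)//.
- apply: eq_measure_integral; first exact: measurable_opp.
  by move=> mF A mA AS; exact: (esym (lebesgue_measureN mA)).
- by move=> y /set_mem; exact: f0.
Qed.

Lemma ae_opp (P : R -> Prop) :
  {ae lam, forall x, P x} -> {ae lam, forall x, P (- x)}.
Proof.
move=> [N [mN N0 PN]]; exists ((fun x : R => - x) @^-1` N); split.
- by rewrite -[X in measurable X]setTI; exact: measurable_opp.
- by rewrite -N0 -[RHS](lebesgue_measureN mN).
- by move=> x /= Px; exact: PN.
Qed.

Lemma ae_reflect (c : R) (P : R -> Prop) :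
  {ae lam, forall x, P x} -> {ae lam, forall x, P (c - x)}.
Proof.
move=> /(ae_shift c)/ae_opp; apply: ae_sub => x.
by rewrite addrC.
Qed.

Lemma Rintegral_shift (c : R) (D : set mT) (f : mT -> mT) :
  measurable D -> measurable_fun setT f ->
  \int[lam]_(x in D) f x = \int[lam]_(x in (fun x : R => x + c) @^-1` D) f (x + c).
Proof.
move=> mD mf; rewrite /Rintegral; congr fine.
rewrite integralE [RHS]integralE.
have mf' : measurable_fun D (EFin \o f).
  by apply/measurable_EFinP; exact: measurable_funS mf.
congr (_ - _)%E.
  rewrite (ge0_integral_shift c)//; last exact: measurable_funepos.
  by apply: eq_integral => x _; rewrite !funeposE.
rewrite (ge0_integral_shift c)//; last exact: measurable_funeneg.
by apply: eq_integral => x _; rewrite !funenegE.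
Qed.

Lemma ae_eq_Rintegral (D : set mT) (f g : mT -> mT) :
  measurable D -> measurable_fun setT f -> measurable_fun setT g ->
  {ae lam, forall x, D x -> f x = g x} ->
  \int[lam]_(x in D) f x = \int[lam]_(x in D) g x.
Proof.
move=> mD mf mg fg; rewrite /Rintegral; congr fine; apply: ae_eq_integral => //.
- by apply/measurable_EFinP; exact: measurable_funS mf.
- by apply/measurable_EFinP; exact: measurable_funS mg.
- by apply: ae_sub fg => x + Dx => /(_ Dx) ->.
Qed.

Lemma measurable_reflect (c : R) (f : mT -> mT) : measurable_fun setT f ->
  measurable_fun setT (fun s : mT => (f (c - s) : mT)).
Proof. by move=> mf; apply: (measurableT_comp mf); exact: measurable_funB. Qed.

End change_of_variable.

(** The response at time t to the input u from the initial state 0. *)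
HB.lock Definition duhamel (R : realType) (b : L2_Rplus R) (t : R)
    (u : LspaceType (Rplus_measure R) (leey 1%E)) : L2_Rplus R :=
  bochner_integral (@lebesgue_measure R) `[0, t]
    (fun s => left_translation (t - s) (rank_one_operator b (u s))).
Canonical duhamel_unlockable := Unlockable duhamel.unlock.

Section duhamel_calculus.
Context (R : realType).
Local Notation lam := (@lebesgue_measure R).
Local Notation mT := (measurableTypeR R).
Local Notation mu := (Rplus_measure R).
Local Notation X := (L2_Rplus R).
Local Notation V := (LspaceType mu (leey 1%E)).
Local Notation S := (@left_translation R).
Implicit Types (b : X) (u v : V) (t s h x : R).

Lemma measurable_Linfty u : measurable_fun [set: mT] (u : mT -> mT).
Proof. exact: measurable_Lspace. Qed.

Lemma duhamelE b t u : 0 <= t ->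
  {ae mu, forall x, duhamel b t u x = \int[lam]_(s in `[0, t]) (u s * b (x + (t - s)))}.
Proof.
move=> t0; rewrite unlock.
by have [] := duhamel_integral b t0 (measurable_Linfty u) (Linfty_norm_ae u).
Qed.

Lemma duhamel_integrable b t u : 0 <= t ->
  {ae mu, forall x, lam.-integrable `[0, t] (fun s => (u s * b (x + (t - s)))%:E)}.
Proof.
move=> t0.
by have [] := duhamel_integral b t0 (measurable_Linfty u) (Linfty_norm_ae u).
Qed.

Lemma duhamel_norm b t u W : 0 <= t ->
  (\int[lam]_(s in `[0%R, t]) (`|u s| * `|b|)%:E <= W%:E)%E -> `|duhamel b t u| <= W.
Proof.
move=> t0; rewrite unlock.
by have [_ _] := duhamel_integral b t0 (measurable_Linfty u) (Linfty_norm_ae u); apply.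
Qed.

Lemma translation_flowE b t (x0 : X) u :
  translation_flow b t x0 u = S t x0 + duhamel b t u.
Proof. by rewrite unlock. Qed.

Lemma duhamel_norm_le b t u : 0 <= t -> `|duhamel b t u| <= `|u| * `|b| * t.
Proof.
move=> t0; apply: duhamel_norm => //.
rewrite -integral_cst_segment0//; apply: ae_ge0_le_integral => //.
- apply/measurable_EFinP; apply: measurable_funM => //.
  by apply: measurableT_comp => //; exact: measurable_funS (measurable_Linfty u).
- have /ae_RplusP := Linfty_norm_ae u; apply: ae_sub => s us /=.
  by rewrite in_itv/= => /andP[s0 _]; rewrite lee_fin ler_wpM2r// us.
Qed.

Lemma duhamel0 b u : duhamel b 0 u = 0.
Proof.
apply/eqP; rewrite -normr_le0.
by rewrite (le_trans (duhamel_norm_le b u (lexx 0)))// mulr0.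
Qed.

Let measurable_integrand (k : mT -> mT) (f : mT -> mT) c :
  measurable_fun setT k -> measurable_fun setT f ->
  measurable_fun setT (fun s : mT => (f s * k (c - s) : mT)).
Proof. by move=> mk mf; apply: measurable_funM => //; exact: measurable_reflect. Qed.

(** The values s in [0, t] and x + (t - s) >= 0 are the only ones at which u and
    b are evaluated, and reflections preserve null sets. *)
Lemma duhamel_ext b t u (k f : mT -> mT) : 0 <= t ->
  measurable_fun setT k -> measurable_fun setT f ->
  {ae mu, forall y, b y = k y} -> {ae mu, forall s, s <= t -> u s = f s} ->
  {ae mu, forall x, duhamel b t u x = \int[lam]_(s in `[0, t]) (f s * k (x + (t - s)))}.
Proof.
move=> t0 mk mf bk uf; apply: (ae_mp (duhamelE b u t0)).
apply: (ae_mp (ae_Rplus_ge0 R)); apply: aeW => x x0 ->.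
under eq_Rintegral do rewrite addrA.
under [RHS]eq_Rintegral do rewrite addrA.
apply: ae_eq_Rintegral => //.
- apply: measurable_integrand; [exact: measurable_L2|exact: measurable_Linfty].
- exact: measurable_integrand.
move/ae_RplusP : bk => /(ae_reflect (x + t)); move/ae_RplusP : uf.
apply: ae_sub2 => s us bs /=; rewrite in_itv/= => /andP[s0 st].
by rewrite us// bs// -addrA addr_ge0// subr_ge0.
Qed.

Lemma duhamel_eq b t u v : 0 <= t ->
  {ae mu, forall s, s <= t -> u s = v s} -> duhamel b t u = duhamel b t v.
Proof.
move=> t0 uv; apply/Lspace_eqP.
apply: (ae_mp (duhamelE b v t0)).
have := duhamel_ext t0 (measurable_L2 b) (measurable_Linfty v) (aeW _ (fun=> erefl)) uv.
by apply: ae_sub => x -> ->.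
Qed.

Lemma duhamelB b b' t u : 0 <= t ->
  duhamel (b - b') t u = duhamel b t u - duhamel b' t u.
Proof.
move=> t0; apply/Lspace_eqP.
apply: (ae_mp (L2_subE (duhamel b t u) (duhamel b' t u))).
apply: (ae_mp (duhamelE b u t0)); apply: (ae_mp (duhamelE b' u t0)).
apply: (ae_mp (duhamel_integrable b u t0)); apply: (ae_mp (duhamel_integrable b' u t0)).
have mB : measurable_fun [set: mT] (fun y : mT => (b y - b' y : mT)).
  by apply: measurable_funB; exact: measurable_L2.
have uu : {ae mu, forall s, s <= t -> u s = u s} by exact: aeW.
have := duhamel_ext t0 mB (measurable_Linfty u) (L2_subE b b') uu.
apply: ae_sub => x -> i1 i2 -> -> ->.
rewrite -[RHS](RintegralB _ i2 i1)//; apply: eq_Rintegral => s _.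
by rewrite mulrBr.
Qed.

(** Both sides are int_0^t u(s) b(x + h + t - s) ds. *)
Lemma duhamel_left_translation b t h u : 0 <= t -> 0 <= h ->
  duhamel (S h b) t u = S h (duhamel b t u).
Proof.
move=> t0 h0; apply/Lspace_eqP.
apply: (ae_mp (left_translationE (duhamel b t u) h0)).
apply: (ae_mp (ae_Rplus_shift h0 (duhamelE b u t0))).
have mS : measurable_fun [set: mT] (fun y : mT => (b (y + h) : mT)).
  exact: (measurableT_comp (measurable_L2 b) (measurable_shift h)).
have uu : {ae mu, forall s, s <= t -> u s = u s} by exact: aeW.
have := duhamel_ext t0 mS (measurable_Linfty u) (left_translationE b h0) uu.
apply: ae_sub => x -> -> ->; apply: eq_Rintegral => s _.
by rewrite addrAC.
Qed.

(** For almost every x, split the integral over [0, t + s] at s; the second part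
    becomes an integral over [0, t] by a shift of the variable. *)
Lemma duhamelD b t s u v : 0 <= t -> 0 <= s ->
  {ae mu, forall r, v r = u (r + s)} ->
  duhamel b (t + s) u = S t (duhamel b s u) + duhamel b t v.
Proof.
move=> t0 s0 vu; have ts0 : 0 <= t + s by rewrite addr_ge0.
apply/Lspace_eqP.
apply: (ae_mp (L2_addE (S t (duhamel b s u)) (duhamel b t v))).
apply: (ae_mp (left_translationE (duhamel b s u) t0)).
apply: (ae_mp (ae_Rplus_shift t0 (duhamelE b u s0))).
apply: (ae_mp (duhamelE b u ts0)); apply: (ae_mp (duhamel_integrable b u ts0)).
have mus : measurable_fun [set: mT] (fun r : mT => (u (r + s) : mT)).
  exact: (measurableT_comp (measurable_Linfty u) (measurable_shift s)).
have vu' : {ae mu, forall r, r <= t -> v r = u (r + s)}.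
  by apply: ae_sub vu => r ->.
have := duhamel_ext t0 (measurable_L2 b) mus (aeW _ (fun=> erefl)) vu'.
apply: ae_sub => x -> iu -> -> -> ->.
set g := fun r : mT => (u r * b (x + (t + s - r)) : mT).
have mg : measurable_fun setT g.
  rewrite /g; under eq_fun do rewrite addrA.
  apply: measurable_integrand; [exact: measurable_L2|exact: measurable_Linfty].
have -> : \int[lam]_(r in `[0, t]) (u (r + s) * b (x + (t - r))) =
    \int[lam]_(r in `]s, (t + s)]) g r.
  rewrite [RHS]Rintegral_itv_obnd_cbnd; last first.
    by apply: integrableS iu => //; apply: subset_itv; rewrite bnd_simp.
  rewrite [RHS](Rintegral_shift s)//.
  rewrite (_ : _ @^-1` _ = `[0, t]%classic); last first.
    by apply/seteqP; split => r /=; rewrite !in_itv/= lerDr lerD2r.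
  by apply: eq_Rintegral => r _; rewrite /g opprD addrACA subrr addr0.
have -> : \int[lam]_(r in `[0, s]) (u r * b (x + t + (s - r))) =
    \int[lam]_(r in `[0, s]) g r.
  by apply: eq_Rintegral => r _; rewrite /g !addrA.
have iu' : lam.-integrable `[0, t + s] (EFin \o g) by exact: iu.
rewrite -(Rintegral_itvB iu') ?bnd_simp//; last by rewrite lerDr.
by rewrite [RHS]addrC subrK.
Qed.

End duhamel_calculus.

(** * Inputs *)

Section inputs.
Context (R : realType).
Local Notation lam := (@lebesgue_measure R).
Local Notation mT := (measurableTypeR R).
Local Notation mu := (Rplus_measure R).
Local Notation V := (LspaceType mu (leey 1%E)).
Implicit Types (u v : V) (t s h x tau : R).

Lemma is_shift_of_ae u v s : 0 <= s ->
  {ae mu, forall r, v r = u (r + s)} -> is_shift (@ae_representative R) s u v.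
Proof.
move=> s0 vu f fu; apply: (ae_mp vu); apply: (ae_mp (ae_Rplus_shift s0 fu)).
by apply: aeW => r; rewrite /shift_fun => -> ->.
Qed.

Lemma ae_of_is_shift u v s : is_shift (@ae_representative R) s u v ->
  {ae mu, forall r, v r = u (r + s)}.
Proof.
move=> /(_ u) H; have {}H := H (aeW _ (fun=> erefl)).
by apply: ae_sub H => r /esym.
Qed.

Lemma shift_input u s : 0 <= s ->
  exists v, {ae mu, forall r, v r = u (r + s)} /\ `|v| <= `|u|.
Proof.
move=> s0; have us := ae_Rplus_shift s0 (Linfty_norm_ae u).
have mus : measurable_fun [set: mT] (fun r : mT => (u (r + s) : mT)).
  exact: (measurableT_comp (measurable_Linfty u) (measurable_shift s)).
have [v Ev] := Linfty_exists mus us.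
exists v; split => //; apply: Linfty_norm_le.
by apply: (ae_mp Ev); apply: ae_sub us => r ur ->.
Qed.

Lemma decaying_shift u v s : 0 <= s -> {ae mu, forall r, v r = u (r + s)} ->
  decaying_inputs u -> decaying_inputs v.
Proof.
move=> s0 vu [tau [C [a [tau0 C0 a0 uC]]]]; exists tau, C, a; split => //.
apply: (ae_mp vu); apply: (ae_mp (ae_Rplus_shift s0 uC)); apply: aeW => r ur -> taur.
rewrite (le_trans (ur _)) ?ler_wpDr// ler_pM2l// ler_expR.
by rewrite mulrDr gerDl mulNr oppr_le0 mulr_ge0// ltW.
Qed.

Lemma decaying_input0 : decaying_inputs (0 : V).
Proof.
exists 0, 1, 1; split => //.
apply: ae_sub (Lspace_zeroE mu (leey 1%E)) => r; rewrite -[Lspace_zero _ _]/(0 : V) => -> _.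
by rewrite normr0 mulr_ge0// expR_ge0.
Qed.

(** Delaying u2 by tau multiplies its decay constant by e^(a tau). *)
Lemma concat_input u1 u2 tau : 0 <= tau ->
  decaying_inputs u1 -> decaying_inputs u2 ->
  exists2 v, decaying_inputs v & is_concat (@ae_representative R) tau u1 u2 v.
Proof.
move=> tau0 d1 [tau2 [C [a [tau20 C0 a0 u2C]]]].
pose h (t : mT) : mT := concat_fun tau u1 u2 t.
have mh : measurable_fun setT h.
  apply: measurable_fun_ifT.
  - by apply: measurable_fun_ltr.
  - exact: measurable_Linfty.
  - exact: (measurableT_comp (measurable_Linfty u2) (measurable_shift (- tau))).
have shiftN (P : R -> Prop) : {ae mu, forall t, P t} ->
    {ae mu, forall t, tau <= t -> P (t - tau)}.
  move=> /ae_RplusP /(ae_shift (- tau)) H; apply/ae_RplusP.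
  by apply: ae_sub H => t Pt t0 taut; apply: Pt; rewrite subr_ge0.
have hM : {ae mu, forall t, `|h t| <= Num.max `|u1| `|u2|}.
  apply: (ae_mp (Linfty_norm_ae u1)); apply: (ae_mp (shiftN _ (Linfty_norm_ae u2))).
  apply: aeW => t H2 H1; rewrite /h /concat_fun le_max.
  by case: ltP => [_|/H2 ->]; rewrite ?H1 ?orbT.
have [v Ev] := Linfty_exists mh hM.
exists v.
- exists (tau + tau2), (C * expR (a * tau)), a; split => //.
  + by rewrite addr_ge0.
  + by rewrite mulr_gt0// expR_gt0.
  apply: (ae_mp Ev); apply: (ae_mp (shiftN _ u2C)); apply: aeW => t H2 -> taut.
  have tt : tau <= t by rewrite (le_trans _ taut)// lerDl.
  rewrite /h /concat_fun ltNge tt/= (le_trans (H2 tt _))//.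
    by rewrite lerBrDl.
  by rewrite -mulrA ler_pM2l// -expRD ler_expR mulrBr !mulNr opprK addrC.
- move=> f1 f2 E1 E2; apply: (ae_mp Ev); apply: (ae_mp E1).
  apply: (ae_mp (shiftN _ E2)); apply: aeW => t H2 H1 ->.
  by rewrite /h /concat_fun; case: ltP => [_|/H2 ->].
Qed.

End inputs.

(** * The translation flow *)

Section translation_flow.
Context (R : realType).
Local Notation lam := (@lebesgue_measure R).
Local Notation mT := (measurableTypeR R).
Local Notation mu := (Rplus_measure R).
Local Notation X := (L2_Rplus R).
Local Notation V := (LspaceType mu (leey 1%E)).
Local Notation S := (@left_translation R).
Variable b : X.
Local Notation phi := (translation_flow b).
Implicit Types (u v : V) (t s h : R).

Lemma flow_shift t s x0 u v : 0 <= t -> 0 <= s ->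
  {ae mu, forall r, v r = u (r + s)} -> phi (t + s) x0 u = phi t (phi s x0 u) v.
Proof.
move=> t0 s0 vu; rewrite !translation_flowE (duhamelD b t0 s0 vu).
by rewrite left_translationD// left_translationA// addrA.
Qed.

Lemma flow_norm_le t x0 u : 0 <= t -> `|phi t x0 u| <= `|x0| + `|u| * `|b| * t.
Proof.
move=> t0; rewrite translation_flowE (le_trans (ler_normD _ _))//.
by apply: lerD; [exact: left_translation_norm_le|exact: duhamel_norm_le].
Qed.

Lemma addrB_regroup (Z : zmodType) (p q r w z : Z) :
  p + (r + z) - (q + w) = p - q + (r - w) + z.
Proof. by rewrite addrA [LHS]addrAC opprD [p + r + _]addrACA. Qed.

Lemma distr_le (Z : normedZmodType R) (p q : Z) (e : R) :
  `|p - q| <= e -> `|q - p| <= e.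
Proof. by rewrite distrC. Qed.

(** Restarting at time t, the increment of the response is the response to b
    replaced by S h b - b, plus the response over a time h.  Hence the increment
    of the flow is controlled by strong continuity at x0 and b alone. *)
Lemma flow_modulus t h x0 u : 0 <= t -> 0 <= h ->
  `|phi (t + h) x0 u - phi t x0 u| <=
  `|S h x0 - x0| + `|u| * `|S h b - b| * t + `|u| * `|b| * h.
Proof.
move=> t0 h0; have [v [vu vN]] := shift_input u t0.
rewrite !translation_flowE {2}(addrC t h) (duhamelD b h0 t0 vu).
rewrite -(left_translationA _ t0 h0) -(duhamel_left_translation b u t0 h0).
have -> : S t (S h x0) + (duhamel (S h b) t u + duhamel b h v) -
    (S t x0 + duhamel b t u) =
    S t (S h x0 - x0) + duhamel (S h b - b) t u + duhamel b h v.
  rewrite left_translationB// duhamelB//.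
  exact: addrB_regroup.
rewrite (le_trans (ler_normD _ _))// lerD//.
  rewrite (le_trans (ler_normD _ _))// lerD//.
    exact: left_translation_norm_le.
  exact: duhamel_norm_le.
rewrite (le_trans (duhamel_norm_le b v h0))//.
by rewrite ler_wpM2r// ler_wpM2r.
Qed.

(** The modulus is used from the smaller of the two times, so that the time
    factor in it is at most t. *)
Lemma flow_continuous_within x0 u :
  {within `[0, +oo[, continuous (fun t : R => phi t x0 u)}.
Proof.
apply/subspace_continuousP => t; rewrite /= in_itv/= andbT => t0.
apply/cvgrPdist_le => e e0.
have e30 : 0 < e / 3 by rewrite divr_gt0.
have c0 : 0 < (`|u| + 1) * (t + 1) by rewrite mulr_gt0// ltr_wpDl.
have ec0 : 0 < e / 3 / ((`|u| + 1) * (t + 1)) by rewrite divr_gt0.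
have d0' : 0 < `|u| * `|b| + 1 by rewrite ltr_wpDl// mulr_ge0.
have ed0 : 0 < e / 3 / (`|u| * `|b| + 1) by rewrite divr_gt0.
have [d1 d10 H1] := left_translation_cvg x0 e30.
have [d2 d20 H2] := left_translation_cvg b ec0.
pose d := Num.min d1 (Num.min d2 (e / 3 / (`|u| * `|b| + 1))).
have d0 : 0 < d by rewrite !lt_min d10 d20.
have key a h : 0 <= a -> a <= t -> 0 <= h -> h <= d ->
    `|phi (a + h) x0 u - phi a x0 u| <= e.
  move=> a0 at' h0; rewrite !le_min => /andP[hd1 /andP[hd2 hd3]].
  rewrite (le_trans (flow_modulus x0 u a0 h0))//.
  have -> : e = e / 3 + e / 3 + e / 3 by lra.
  apply: lerD; first apply: lerD.
  - by apply: H1; rewrite h0.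
  - apply: (@le_trans _ _ ((`|u| + 1) * (e / 3 / ((`|u| + 1) * (t + 1))) * (t + 1))).
      apply: ler_pM => //.
        apply: ler_pM => //; first by rewrite lerDl.
        by apply: H2; rewrite h0.
      by rewrite (le_trans at')// lerDl.
    by rewrite mulrAC mulrC divfK// gt_eqF.
  - apply: (@le_trans _ _ ((`|u| * `|b| + 1) * (e / 3 / (`|u| * `|b| + 1)))).
      by apply: ler_pM => //; rewrite lerDl.
    by rewrite mulrC divfK// gt_eqF.
exists d => //= s; rewrite /ball_/= => ts; rewrite in_itv/= andbT => s0.
have [st|ts'] := leP s t.
  have := key s (t - s) s0 st; rewrite (_ : s + (t - s) = t); last first.
    by rewrite addrC subrK.
  apply.
    by rewrite subr_ge0.
  by rewrite (le_trans (ler_norm _))// ltW.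
have E : t + (s - t) = s by rewrite addrC subrK.
have := key t (s - t) t0 (lexx t); rewrite E => K.
apply: distr_le; apply: K; first by rewrite subr_ge0 ltW.
by rewrite (le_trans (ler_norm _))// distrC ltW.
Qed.

Lemma translation_dynamical_system :
  dynamical_system_with_inputs (@ae_representative R) (@decaying_inputs R) phi.
Proof.
split.
- by exists 0; exact: decaying_input0.
- by move=> u _; exists u; exact: aeW.
- move=> u v f _ _ fu fv; apply/Lspace_eqP.
  by apply: (ae_mp fu); apply: ae_sub fv => r <- ->.
- move=> u s du s0; have [v [vu vN]] := shift_input u s0.
  exists v; split => //; first exact: decaying_shift vu du.
  exact: is_shift_of_ae.
- by move=> u1 u2 tau d1 d2 tau0; exact: concat_input.
- by move=> x0 u _; rewrite translation_flowE left_translation0 duhamel0 addr0.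
- move=> x0 u v t s _ s0 t0 _ /ae_of_is_shift vu; exact: flow_shift.
- by move=> x0 u _; exact: flow_continuous_within.
- move=> x0 u1 u2 tau _ _ tau0 [f1 [f2 [E1 E2 f12]]] t /andP[t0 ttau].
  rewrite !translation_flowE; congr (_ + _); apply: duhamel_eq => //.
  apply: (ae_mp E1); apply: (ae_mp E2); apply: (ae_mp (ae_Rplus_ge0 R)).
  by apply: aeW => s s0 <- <- st; rewrite f12// s0 (le_trans st).
Qed.

Lemma translation_bounded_reachability : bounded_reachability_sets (@decaying_inputs R) phi.
Proof.
move=> C tau C0 tau0; exists (C + C * `|b| * tau).
move=> _ [t [x0 [u [/andP[t0 ttau] x0C _ uC ->]]]].
rewrite (le_trans (flow_norm_le x0 u t0))// lerD//.
by apply: ler_pM => //; rewrite ler_wpM2r.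
Qed.

Lemma translation_continuous_at0 : continuous_at_equilibrium0 (@decaying_inputs R) phi.
Proof.
move=> eps h eps0 h0.
have c0 : 0 < 1 + `|b| * h by rewrite ltr_pwDl// mulr_ge0// ltW.
exists (eps / (1 + `|b| * h)); first by rewrite divr_gt0.
move=> t x0 u /andP[t0 th] x0d _ ud.
rewrite (le_trans (flow_norm_le x0 u t0))//.
apply: (@le_trans _ _ (eps / (1 + `|b| * h) * (1 + `|b| * h))); last first.
  by rewrite divfK// gt_eqF.
rewrite mulrDr mulr1 lerD// -mulrA.
by apply: ler_pM => //; [rewrite mulr_ge0|rewrite ler_wpM2l].
Qed.

Lemma classK_id : classK (@idfun R).
Proof. by split => //; apply: continuous_subspaceT => x; exact: cvg_id. Qed.

Lemma translation_zero_input_stable :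
  zero_input_uniformly_globally_stable (@decaying_inputs R) phi.
Proof.
split; first exact: decaying_input0.
exists idfun, idfun; split; [exact: classK_id|exact: classK_id|].
move=> x0 u -> t t0; rewrite (le_trans (flow_norm_le x0 0 t0))//.
by rewrite normr0 !mul0r.
Qed.

(** The exponential distribution has total mass 1. *)
Lemma integral_expR_le (a t : R) : 0 < a -> 0 <= t ->
  (\int[lam]_(s in `[0%R, t]) (expR (- a * s))%:E <= a^-1%:E)%E.
Proof.
move=> a0 t0.
have -> : (\int[lam]_(s in `[0%R, t]) (expR (- a * s))%:E =
    a^-1%:E * \int[lam]_(s in `[0%R, t]) (exponential_pdf a s)%:E)%E.
  rewrite -ge0_integralZl_EFin//.
  - apply: eq_integral => s; rewrite inE/= in_itv/= => /andP[s0 _].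
    rewrite /exponential_pdf patchE mem_set/= ?in_itv/= ?s0//.
    by rewrite -EFinM mulKf// gt_eqF.
  - by move=> s _; rewrite lee_fin exponential_pdf_ge0// ltW.
  - apply/measurable_EFinP; apply: (@measurable_funS _ _ _ _ setT) => //.
    exact: measurable_exponential_pdf.
  - by rewrite invr_ge0 ltW.
rewrite -[leRHS]mule1 -(integral_exponential_pdf a0).
apply: lee_wpmul2l; first by rewrite lee_fin invr_ge0 ltW.
apply: ge0_subset_integral => //.
- by apply/measurable_EFinP; exact: measurable_exponential_pdf.
- by move=> s _; rewrite lee_fin exponential_pdf_ge0// ltW.
Qed.

(** Restart the flow at a time T from which the input contributes at most
    eps / 2 for ever; the state at time T fades because left translation
    is strongly stable. *)
Lemma translation_weak_gain0 : of_weak_asymptotic_gain (@decaying_inputs R) phi (cst 0).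
Proof.
split; first by right.
move=> eps x0 u eps0 [tau [C [a [tau0 C0 a0 uC]]]].
have e20 : 0 < eps / 2 by rewrite divr_gt0.
pose c := C * `|b| * a^-1 + 1.
have c0 : 0 < c by rewrite ltr_wpDl// !mulr_ge0// ?invr_ge0 ltW.
(* T is chosen so that C e^(- a T) |b| / a <= eps / 2, using e^y >= y; the
   summand 1 in c keeps c positive when b = 0 *)
pose T := Num.max tau (c / (eps / 2) / a).
have T0 : 0 <= T by rewrite le_max tau0.
have eT : C * expR (- a * T) * `|b| * a^-1 <= eps / 2.
  have h1 : c / (eps / 2) <= expR (a * T).
    apply: (@le_trans _ _ (a * T)); last by rewrite (le_trans _ (expR_ge1Dx _))// lerDr.
    by rewrite -ler_pdivrMl// [leLHS]mulrC le_max lexx orbT.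
  rewrite mulNr expRN; move: (expR_gt0 (a * T)) h1; set E := expR _ => E0 h1.
  have -> : C / E * `|b| * a^-1 = (c - 1) / E by rewrite /c addrK; ring.
  rewrite ler_pdivrMr//; apply: (@le_trans _ _ c); first by rewrite gerBl.
  by rewrite [leRHS]mulrC -ler_pdivrMr.
have [v [vu vN]] := shift_input u T0.
have [T' T'0 HT'] := left_translation_cvg0 (phi T x0 u) e20.
exists (T + T'); first by rewrite addr_ge0.
move=> t tT; rewrite /cst addr0.
have tT0 : 0 <= t - T by rewrite subr_ge0 (le_trans _ tT)// lerDl.
rewrite -(subrK T t) (flow_shift x0 tT0 T0 vu) translation_flowE.
rewrite (le_trans (ler_normD _ _))// (splitr eps) lerD//.
  by apply: HT'; rewrite lerBrDl.
apply: duhamel_norm => //.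
apply: (@le_trans _ _ (\int[lam]_(s in `[0%R, (t - T)%R])
    ((C * expR (- a * T) * `|b|)%R%:E * (expR (- a * s)%R)%:E))%E).
  apply: ae_ge0_le_integral => //.
  - apply/measurable_EFinP; apply: measurable_funM => //.
    by apply: measurableT_comp => //; exact: measurable_funS (measurable_Linfty v).
  - by move=> s _; rewrite -EFinM lee_fin !mulr_ge0// ?expR_ge0// ltW.
  - apply: emeasurable_funM => //; apply/measurable_EFinP.
    apply: measurableT_comp => //; exact: measurable_funM.
  - have : {ae lam, forall s, 0 <= s -> `|v s| <= C * expR (- a * (s + T))}.
      apply/ae_RplusP; apply: (ae_mp vu); apply: (ae_mp (ae_Rplus_shift T0 uC)).
      apply: (ae_mp (ae_Rplus_ge0 R)); apply: aeW => s s0 us ->; apply: us.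
      by rewrite (@le_trans _ _ T) ?lerDr// le_max lexx.
    apply: ae_sub => s vs; rewrite /= in_itv/= => /andP[s0 _].
    rewrite -EFinM lee_fin mulrAC ler_wpM2r// (le_trans (vs s0))//.
    by rewrite -mulrA -expRD mulrDr addrC.
rewrite ge0_integralZl_EFin//.
- apply: (@le_trans _ _ ((C * expR (- a * T) * `|b|)%:E * a^-1%:E)%E).
    apply: lee_wpmul2l; last exact: integral_expR_le.
    by rewrite lee_fin !mulr_ge0// ?expR_ge0// ltW.
  by rewrite -EFinM lee_fin.
- apply/measurable_EFinP; apply: measurableT_comp => //; exact: measurable_funM.
- by rewrite !mulr_ge0// ?expR_ge0// ltW.
Qed.


(** * Failure of local stability *)

Section instability.
Hypotheses (b_ge0 : {ae mu, forall z : R, 0 <= b z})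
  (b_notin_L1 : (b : R -> R) \notin Lfun mu 1%E).

(** A version of b that is nonnegative everywhere. *)
Let bp (z : mT) : mT := Num.max 0 (b z).

Let mbp : measurable_fun setT bp.
Proof. by apply: measurable_maxr => //; exact: measurable_L2. Qed.

Let bp_ge0 z : 0 <= bp z. Proof. by rewrite /bp le_max lexx. Qed.

Let b_bp : {ae mu, forall z, b z = bp z}.
Proof. by apply: ae_sub b_ge0 => z b0; rewrite /bp max_r. Qed.

Let mbpE (D : set mT) : measurable_fun D (fun z => (bp z)%:E).
Proof. by apply/measurable_EFinP; exact: measurable_funS mbp. Qed.

(** On [0, 1] one has b <= 1 + b^2, which is integrable, so the divergence comes
    from the tail. *)
Lemma integral_tail_infty : (\int[lam]_(z in `[1%R, +oo[) (bp z)%:E = +oo)%E.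
Proof.
apply/eqP; rewrite -leye_eq leNgt; apply/negP => tail.
move/negP : b_notin_L1; apply; apply/andP; split; rewrite inE.
  exact: measurable_L2.
rewrite /= /finite_norm Lnorm1.
have -> : (\int[mu]_x `|(EFin \o b) x| = \int[mu]_x (bp x)%:E)%E.
  apply: ge0_ae_eq_integral => //.
  - by apply: measurableT_comp => //; apply/measurable_EFinP; exact: measurable_L2.
  - by move=> x _; rewrite lee_fin.
  - by apply: ae_sub b_bp => x /= -> _; rewrite ger0_norm.
rewrite ge0_integral_Rplus//.
have -> : (`[0%R, +oo[%classic : set mT) = `[0%R, 1%R[%classic `|` `[1%R, +oo[%classic.
  apply/seteqP; split => x /=; rewrite !in_itv/= !andbT.
    by move=> x0; have [x1|x1] := ltP x 1; [left; rewrite x0|right].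
  by move=> [/andP[]//|]; exact: le_trans.
rewrite ge0_integral_setU//; last 2 first.
- by move=> x _; rewrite lee_fin.
- apply/disj_setPS => x [] /=; rewrite !in_itv/= andbT => /andP[_ x1].
  by rewrite leNgt x1.
rewrite lte_add_pinfty//.
apply: (@le_lt_trans _ _ (\int[lam]_(x in `[0%R, 1%R]) (1%:E + (b x ^+ 2)%:E))%E).
  apply: (@le_trans _ _ (\int[lam]_(x in `[0%R, 1%R]) (bp x)%:E)%E).
    apply: ge0_subset_integral => //.
    by move=> x _; rewrite lee_fin.
    by move=> x /=; rewrite !in_itv/= => /andP[-> /ltW ->].
  apply: ge0_le_integral => //.
  - by move=> x _; rewrite lee_fin.
  - by apply: emeasurable_funD => //; apply: measurable_funS (measurable_L2_sqr b).
  - move=> x _; rewrite -EFinD lee_fin /bp ge_max addr_ge0 ?sqr_ge0//=.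
    by nra.
rewrite ge0_integralD//; last 2 first.
- by move=> x _; rewrite lee_fin sqr_ge0.
- by apply: measurable_funS (measurable_L2_sqr b).
rewrite integral_cst_segment0// lte_add_pinfty// ?ltry//.
apply: (@le_lt_trans _ _ (\int[lam]_(x in `[0%R, +oo[) (b x ^+ 2)%:E)%E).
  apply: ge0_subset_integral => //.
  - by apply: measurable_funS (measurable_L2_sqr b).
  - by move=> x _; rewrite lee_fin sqr_ge0.
  - by move=> x /=; rewrite !in_itv/= andbT => /andP[].
by rewrite (le_lt_trans (tail_le_norm_sqr _ (lexx 0)))// ltry.
Qed.

Lemma integral_tail_unbounded (M : R) :
  exists n : nat, (M%:E < \int[lam]_(z in `[1%R, n%:R]) (bp z)%:E)%E.
Proof.
have nd : nondecreasing_seq (fun n : nat => `[1, n%:R]%classic : set mT).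
  move=> m n mn; apply/subsetPset => x /=; rewrite !in_itv/= => /andP[-> xm]/=.
  by rewrite (le_trans xm)// ler_nat.
have := @ge0_nondecreasing_set_cvg_integral _ mT R _ (fun z => (bp z)%:E) lam nd
  (fun n => measurable_itv _) (fun n => @mbpE _)
  (fun n z _ => bp_ge0 z : (0 <= (bp z)%:E)%E).
rewrite (_ : \bigcup_i _ = `[1, +oo[%classic); last first.
  apply/seteqP; split => [x [n _]|x]; rewrite /= !in_itv/= ?andbT.
    by case/andP.
  move=> x1; exists (Num.truncn x).+1 => //=.
  by rewrite in_itv/= x1 ltW// truncnS_gt.
rewrite integral_tail_infty => H.
have [n _ Hn] := H _ (open_ereal_gt' (ltry M)).
by exists n; exact: Hn n (leqnn n).
Qed.

(** For almost every x in [0, 1], the response at x is r times the integral of b over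
    [x, x + n], an interval that contains [1, n]; and a function that is at least
    c >= 0 on [0, 1] has L2 norm at least c. *)
Lemma duhamel_indicator_lower (r : R) (n : nat) u : (0 < n)%N -> 0 <= r ->
  {ae mu, forall s, u s = if s <= n%:R then r else 0} ->
  (\int[lam]_(z in `[1%R, n%:R]) (r * bp z)%:E <= (`|duhamel b n%:R u|)%:E)%E.
Proof.
move=> n0 r0 uE; have nR0 : (0 : R) <= n%:R by [].
set I := duhamel b n%:R u.
set B := (\int[lam]_(z in `[1%R, n%:R]) (r * bp z)%:E)%E.
have B0 : (0 <= B)%E.
  by apply: integral_ge0 => x _; rewrite lee_fin mulr_ge0.
have mrbp' : measurable_fun [set: mT] (fun z : mT => (r * bp z : mT)).
  exact: measurable_funM.
have mrbp : measurable_fun [set: mT] (fun z : mT => (r * bp z)%:E).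
  exact/measurable_EFinP.
have IB : {ae mu, forall x, x <= 1 -> (B <= (I x)%:E)%E}.
  apply: (ae_mp (duhamelE b u nR0)); apply: (ae_mp (duhamel_integrable b u nR0)).
  apply: (ae_mp (ae_Rplus_ge0 R)); apply: aeW => x x0 ix -> x1.
  rewrite /Rintegral fineK; last exact: integrable_fin_num ix.
  have -> : (\int[lam]_(s in `[0%R, n%:R]) (u s * b (x + (n%:R - s)))%:E =
      \int[lam]_(s in `[0%R, n%:R]) (r * bp (x + n%:R - s))%:E)%E.
    apply: ae_eq_integral => //.
    - by case/integrableP : ix.
    - by apply/measurable_EFinP; apply: measurable_funS (measurable_reflect (x + n%:R) mrbp').
    move/ae_RplusP : b_bp => /(ae_reflect (x + n%:R)); move/ae_RplusP : uE.
    apply: ae_sub2 => s us bs; rewrite /= in_itv/= => /andP[s0 sn].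
    by rewrite us// sn addrA bs// -addrA addr_ge0// subr_ge0.
  apply: (@le_trans _ _ (\int[lam]_(z in `[x, (x + n%:R)%R]) (r * bp z)%:E)%E).
    apply: ge0_subset_integral => //.
    + by apply: measurable_funS mrbp.
    + by move=> z _; rewrite lee_fin mulr_ge0.
    + move=> z /=; rewrite !in_itv/= => /andP[z1 zn].
      by rewrite (le_trans x1 z1)/= (le_trans zn)// lerDr.
  rewrite (ge0_integral_shift (x + n%:R))//; last 2 first.
  - by apply: measurable_funS mrbp.
  - by move=> z _; rewrite lee_fin mulr_ge0.
  rewrite ge0_integral_opp//; last 3 first.
  - by rewrite -[X in measurable X]setTI; exact: measurable_shift.
  - by apply: measurable_funS (measurableT_comp mrbp (measurable_shift (x + n%:R))).
  - by move=> z _; rewrite lee_fin mulr_ge0.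
  rewrite le_eqVlt; apply/orP; left; apply/eqP.
  rewrite (_ : _ @^-1` _ = `[0, n%:R]%classic); last first.
    apply/seteqP; split => s /=; rewrite !in_itv/= => /andP[h1 h2]; lra.
  by apply: eq_integral => s _; rewrite addrC.
have H (c : R) : 0 <= c -> (c%:E <= B)%E -> c <= `|I|.
  move=> c0 cB; rewrite -(@ler_pXn2r _ 2) ?nnegrE// -lee_fin.
  rewrite (L2_norm_sqr_ae (measurable_L2 I) (aeW _ (fun=> erefl))).
  apply: (@le_trans _ _ (\int[lam]_(x in `[0%R, 1%R]) (c ^+ 2)%:E)%E).
    by rewrite integral_cst_segment0// mulr1.
  apply: (@le_trans _ _ (\int[lam]_(x in `[0%R, 1%R]) (I x ^+ 2)%:E)%E).
    apply: ae_ge0_le_integral => //.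
    + by move=> x _; rewrite lee_fin sqr_ge0.
    + by move=> x _; rewrite lee_fin sqr_ge0.
    + by apply: measurable_funS (measurable_L2_sqr I).
    move/ae_RplusP : IB; apply: ae_sub => x IBx; rewrite /= in_itv/= => /andP[x0 x1].
    have cI : c <= I x by rewrite -lee_fin (le_trans cB)// IBx.
    by rewrite lee_fin lerXn2r ?nnegrE// (le_trans c0).
  apply: ge0_subset_integral => //.
  + by apply: measurable_funS (measurable_L2_sqr I).
  + by move=> x _; rewrite lee_fin sqr_ge0.
  + by move=> x /=; rewrite !in_itv/= andbT => /andP[].
move: {IB} B0 H; clearbody B; case: B => [c c0 H|_ H|//].
  by rewrite lee_fin H.
have := H (`|I| + 1) _ (leey _); rewrite gerDl ler10 => /(_ _)/negP.
by rewrite addr_ge0// => /(_ isT).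
Qed.

Lemma truncated_constant_input (r : R) (n : nat) : 0 <= r ->
  exists u, [/\ decaying_inputs u, `|u| <= r &
    {ae mu, forall s, u s = if s <= n%:R then r else 0}].
Proof.
move=> r0; pose h (s : mT) : mT := if s <= n%:R then r else 0.
have mh : measurable_fun setT h.
  apply: measurable_fun_ifT; [|exact: measurable_cst|exact: measurable_cst].
  exact: measurable_fun_ler.
have hr : {ae mu, forall s, `|h s| <= r}.
  by apply: aeW => s; rewrite /h; case: ifPn; rewrite ?normr0// ger0_norm.
have [u uE] := Linfty_exists mh hr.
exists u; split => //.
- exists n.+1%:R, 1, 1; split => //; apply: ae_sub uE => s -> ns.
  have sn : (n%:R : R) < s by rewrite (lt_le_trans _ ns)// ltr_nat.
  have -> : h s = 0 by rewrite /h leNgt sn.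
  by rewrite normr0 mul1r expR_ge0.
- by apply: Linfty_norm_le; apply: (ae_mp uE); apply: ae_sub hr => s hs ->.
Qed.

(** The inputs of height r on [0, n] have norm at most r, but their responses at
    time n from the state 0 are unbounded in n. *)
Lemma translation_not_locally_stable : ~ uniformly_locally_stable (@decaying_inputs R) phi.
Proof.
move=> [sigma [gamma [r [[_ _ sigma0] [_ incg gamma0] r0 est]]]].
have gammar u : `|u| <= r -> gamma `|u| <= gamma r.
  rewrite le_eqVlt => /predU1P[->//|ur]; apply/ltW/incg => //; rewrite in_itv/= andbT//.
  exact: ltW.
have [n Hn] := integral_tail_unbounded (gamma r / r).
have n0 : (0 < n)%N.
  rewrite lt0n; apply/eqP => n0; move: Hn; rewrite n0.
  rewrite (_ : `[1, 0%:R]%classic = set0) ?integral_set0; last first.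
    by apply/seteqP; split => // z /=; rewrite in_itv/= => /andP[]; lra.
  rewrite lte_fin ltNge divr_ge0// ?ltW//.
  by rewrite -gamma0 incg// in_itv/= andbT// ltW.
have [u [du ur uE]] := truncated_constant_input n (ltW r0).
have := est 0 u du _ ur n%:R (ler0n _ n); rewrite normr0 sigma0 add0r.
move=> /(_ (ltW r0)); rewrite translation_flowE.
have -> : S n%:R (0 : X) = 0.
  by rewrite -[X in S _ X](subrr (0 : X)) left_translationB// subrr.
rewrite add0r => le1.
have := duhamel_indicator_lower n0 (ltW r0) uE.
have -> : (\int[lam]_(z in `[1%R, n%:R]) (r * bp z)%:E =
    r%:E * \int[lam]_(z in `[1%R, n%:R]) (bp z)%:E)%E.
  have r0' := ltW r0; rewrite -ge0_integralZl_EFin//.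
  by move=> z _; rewrite lee_fin.
move=> le2.
have : (r%:E * (gamma r / r)%:E < (gamma r)%:E)%E.
  apply: (@lt_le_trans _ _ (r%:E * \int[lam]_(z in `[1%R, n%:R]) (bp z)%:E)%E).
    by rewrite lte_pmul2l.
  by apply: (le_trans le2); rewrite lee_fin (le_trans le1)// gammar.
by rewrite -EFinM mulrC divfK ?ltxx// gt_eqF.
Qed.

Lemma locally_stable_of_globally_stable : uniformly_globally_stable (@decaying_inputs R) phi ->
  uniformly_locally_stable (@decaying_inputs R) phi.
Proof.
move=> [sigma [gamma [Ks Kg est]]]; exists sigma, gamma, 1; split => //.
by move=> x0 u du _ _; exact: est.
Qed.

End instability.

End translation_flow.

Theorem mainTheorem3 (R : realType) (b : L2_Rplus R)
    (b_ge0 : {ae Rplus_measure R, forall z : R, 0 <= b z})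
    (b_notin_L1 : (b : R -> R) \notin L1_Rplus R) :
  let Inp := @decaying_inputs R in
  let phi := translation_flow b in
  [/\ dynamical_system_with_inputs (@ae_representative R) Inp phi,
      bounded_reachability_sets Inp phi,
      continuous_at_equilibrium0 Inp phi,
      zero_input_uniformly_globally_stable Inp phi &
      of_weak_asymptotic_gain Inp phi (cst 0)] /\
  ~ uniformly_locally_stable Inp phi /\
  ~ weakly_input_to_state_stable Inp phi.
Proof.
move=> Inp phi.
have not_stable := translation_not_locally_stable b_ge0 b_notin_L1.
split; last by split => // -[UGS _]; exact/not_stable/locally_stable_of_globally_stable.
split.
- exact: translation_dynamical_system.
- exact: translation_bounded_reachability.
- exact: translation_continuous_at0.
- exact: translation_zero_input_stable.
- exact: translation_weak_gain0.
Qed.
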